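(* Let $X$ be a Hausdorff topological space, $Y\subset X\times S^1$ an open subset, and $\mathbf{F}:Y\times\mathbb{R}\to Y$ a continuous flow such that: $(\Phi1)$ the orbits of $\mathbf{F}$ are exactly the connected components of the intersections $(\{x\}\times S^1)\cap Y$ for all $x\in X$; $(\Phi2)$ $\mathbf{F}$ admits a flow-box chart at each point of $Y$; $(\Phi3)$ the set $B=\{x\in X\mid \{x\}\times S^1\subset Y\}$ is dense in $X$; $(\Phi4)$ for each $x\in X$ the intersection $L_x:=(\{x\}\times S^1)\cap Y$ has only finitely many connected components. Let $h:Y\to Y$ be a homeomorphism such that (1) $h(L_x)\subset\{x\}\times S^1$ for each $x\in X$; (2) for each $x\in B$ the restriction $h:\{x\}\times S^1\to\{x\}\times S^1$ has degree $-1$ as a self-map of a circle. Then there exists a unique continuous function $\alpha:Y\to\mathbb{R}$ such that (a) $h^2(x,s)=\mathbf{F}\bigl((x,s),\alpha(x,s)\bigr)$ for all $(x,s)\in Y$; in particular $h^2$ preserves every orbit of $\mathbf{F}$; (b) for $(x,s)\in Y$, $\alpha(x,s)=0$ if and only if $h^2(x,s)=(x,s)$; (c) if in addition $X$ is a manifold of class $C^r$ $(0\le r\le\infty)$, $\mathbf{F}$ is $C^r$ and admits $C^r$ flow-box charts, and $h$ is $C^r$, then $\alpha$ is $C^r$ as well.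
   Context: A (global) flow on a topological space $Y$ is a continuous map $\mathbf{F}:Y\times\mathbb{R}\to Y$ with $\mathbf{F}_0=\mathrm{id}_Y$ and $\mathbf{F}_s\circ\mathbf{F}_t=\mathbf{F}_{s+t}$ for all $s,t\in\mathbb{R}$, where $\mathbf{F}_s(y)=\mathbf{F}(y,s)$. The orbit of $y$ is $\mathbf{F}(\{y\}\times\mathbb{R})$. Here $h^2=h\circ h$. Flow-box chart: let $y\in Y$ be a non-fixed point of $\mathbf{F}$, $T$ a topological space, $U\subset Y$ an open neighborhood of $y$, and $\phi=(\zeta,\rho):U\to T\times\mathbb{R}$ an open embedding. The pair $(\phi,U)$ is a flow-box chart at $y$ if there exist $\varepsilon>0$ and an open neighborhood $V$ of $y$ such that $\phi\circ\mathbf{F}(z,t)=(\zeta(z),\rho(z)+t)$ for all $(z,t)\in V\times(-\varepsilon,\varepsilon)$ (in particular $\mathbf{F}(z,t)\in U$ for such $(z,t)$). It is a $C^r$ flow-box chart if $\phi$ is a $C^r$ embedding. *)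

(* Defs.v *)
From HB Require Import structures.
From mathcomp Require Import all_boot all_order all_algebra.
From mathcomp Require Import all_classical all_reals all_analysis.

Set Implicit Arguments.
Unset Strict Implicit.
Unset Printing Implicit Defensive.

Import Order.TTheory GRing.Theory Num.Theory.
Import numFieldNormedType.Exports.

Local Open Scope classical_set_scope.
Local Open Scope ring_scope.

(* [f] is an open embedding of [U] into [N]. Maps defined on an open subset
   [U] are represented by total functions whose values off [U] are junk. *)
Definition open_embedding (M N : topologicalType) (U : set M) (f : M -> N) :=
  [/\ open U,
      (forall x, U x -> {for x, continuous f}),
      {in U &, injective f}
    & forall W, open W -> W `<=` U -> open (f @` W)].

Definition homeomorphism (M N : topologicalType) (h : M -> N) :=
  continuous h /\
  exists k : N -> M, [/\ continuous k, cancel h k & cancel k h].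

Definition components (M : topologicalType) (A : set M) : set (set M) :=
  [set connected_component A z | z in A].

Section Flows.
Context {R : realType} {Y : topologicalType}.
Implicit Types F : Y * R -> Y.

Definition is_flow F :=
  [/\ continuous F,
      forall y, F (y, 0) = y
    & forall y s t, F (F (y, t), s) = F (y, s + t)].

Definition flow_orbit F (y : Y) : set Y := [set F (y, t) | t in [set: R]].

Definition flow_box_chart F (y : Y) (T : topologicalType)
    (U : set Y) (phi : Y -> T * R) :=
  [/\ exists t, F (y, t) <> y,
      U y,
      open_embedding U phi
    & exists e : R, exists V : set Y,
        [/\ 0 < e, open V, V y &
            forall z t, V z -> - e < t < e ->
              U (F (z, t)) /\ phi (F (z, t)) = ((phi z).1, (phi z).2 + t)]].

End Flows.

Section Circle.
Variable R : realType.

Definition circle : set (R * R) := [set p | p.1 ^+ 2 + p.2 ^+ 2 = 1].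

Lemma expi_subproof (t : R) : (cos t, sin t) \in circle.
Proof. by apply/mem_set; rewrite /circle /= cos2Dsin2. Qed.

Definition expi (t : R) : circle := exist _ (cos t, sin t) (expi_subproof t).

(* Degree of a circle map through a lift to the universal cover [expi]. *)
Definition has_degree (g : circle -> circle) (d : int) :=
  exists G : R -> R,
    [/\ continuous G,
        forall t, expi (G t) = g (expi t)
      & forall t, G (t + 2 * pi) = G t + d%:~R * (2 * pi)].

End Circle.
Arguments circle R : clear implicits.

Section Fibres.
Context {R : realType} {X : topologicalType} (Y : set (X * circle R)).

Definition fibre (x : X) : set (X * circle R) := [set x] `*` [set: circle R].

Definition leaf (x : X) : set (X * circle R) := fibre x `&` Y.

Definition full_fibres : set X := [set x | fibre x `<=` Y].

Lemma full_fibre_mem (x : X) (Bx : full_fibres x) (s : circle R) :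
  (x, s) \in Y.
Proof. by apply/mem_set/Bx. Qed.

(* The restriction [{x} * S^1 -> {x} * S^1] of [h], as a self-map of the
   circle; it represents [h] only when [h] preserves the fibre over [x]. *)
Definition fibre_map (h : Y -> Y) (x : X) (Bx : full_fibres x)
    (s : circle R) : circle R :=
  (set_val (h (exist _ (x, s) (full_fibre_mem Bx s)))).2.

End Fibres.

(* [Some k] stands for C^k and [None] for C^oo. *)
Definition smoothness := option nat.

Section Smooth.
Context {R : realType}.

(* Meant for open sets [U] of finite-dimensional spaces: there, the derivative
   [x |-> 'd f x] is C^k iff [x |-> 'd f x v] is C^k for every [v]. *)
Fixpoint Ck_on (k : nat) (V W : normedModType R) (U : set V) (f : V -> W) :=
  match k with
  | 0 => forall x, U x -> {for x, continuous f}
  | k'.+1 => (forall x, U x -> differentiable f x) /\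
             forall v, Ck_on k' U (fun x => 'd f x v)
  end.

Definition Cr_on (r : smoothness) (V W : normedModType R) (U : set V)
    (f : V -> W) :=
  if r is Some k then Ck_on k U f else forall k, Ck_on k U f.

Record chart (M : Type) (E : Type) := Chart {
  chart_dom : set M;
  chart_map : M -> E  (* irrelevant outside chart_dom *) }.

(* [f : U -> N], restricted to the domain of [c] and to the preimage of that
   of [c'], has a C^r coordinate expression [g = c' \o f \o c^-1]. *)
Definition Cr_in_charts (r : smoothness) (M N : Type)
    (E E' : normedModType R) (c : chart M E) (c' : chart N E')
    (U : set M) (f : M -> N) :=
  let D := U `&` chart_dom c `&` f @^-1` chart_dom c' in
  exists g : E -> E',
    Cr_on r (chart_map c @` D) g /\
    forall x, D x -> g (chart_map c x) = chart_map c' (f x).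

(* [A] is a C^r atlas modelled on [E]; for [E = 'rV[R]_n] it makes [M] an
   [n]-dimensional C^r manifold without boundary. *)
Definition Cr_atlas (r : smoothness) (M : topologicalType)
    (E : normedModType R) (A : set (chart M E)) :=
  [/\ forall c, A c -> open_embedding (chart_dom c) (chart_map c),
      forall x, exists2 c, A c & chart_dom c x
    & forall c c', A c -> A c' -> Cr_in_charts r c c' [set: M] id].

Definition Cr_map_on (r : smoothness) (M N : topologicalType)
    (E E' : normedModType R) (A : set (chart M E)) (A' : set (chart N E'))
    (U : set M) (f : M -> N) :=
  (forall x, U x -> {for x, continuous f}) /\
  forall c c', A c -> A' c' -> Cr_in_charts r c c' U f.

Definition Cr_map (r : smoothness) (M N : topologicalType)
    (E E' : normedModType R) (A : set (chart M E)) (A' : set (chart N E'))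
    (f : M -> N) :=
  Cr_map_on r A A' [set: M] f.

(* An open C^r embedding is a C^r diffeomorphism onto its (open) image. *)
Definition Cr_open_embedding (r : smoothness) (M N : topologicalType)
    (E E' : normedModType R) (A : set (chart M E)) (A' : set (chart N E'))
    (U : set M) (f : M -> N) :=
  [/\ open_embedding U f,
      Cr_map_on r A A' U f
    & exists g : N -> M,
        (forall x, U x -> g (f x) = x) /\ Cr_map_on r A' A (f @` U) g].

Definition prod_chart (M N E E' : Type) (c : chart M E) (c' : chart N E') :
    chart (M * N) (E * E') :=
  Chart (chart_dom c `*` chart_dom c')
        (fun z => (chart_map c z.1, chart_map c' z.2)).

Definition prod_atlas (M N E E' : Type) (A : set (chart M E))
    (A' : set (chart N E')) : set (chart (M * N) (E * E')) :=
  [set prod_chart c c' | c in A & c' in A'].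

Definition open_subatlas (M E : Type) (Y : set M) (A : set (chart M E)) :
    set (chart Y E) :=
  [set Chart (set_val @^-1` chart_dom c) (chart_map c \o set_val) | c in A].
Arguments open_subatlas [M E] Y A.

Definition line_atlas : set (chart R R) := [set Chart setT id].

(* Stereographic projections from (0, 1) and (0, -1). *)
Definition circle_atlas : set (chart (circle R) R) :=
  [set Chart [set p : circle R | (set_val p).2 != 1]
             (fun p => (set_val p).1 / (1 - (set_val p).2));
       Chart [set p : circle R | (set_val p).2 != -1]
             (fun p => (set_val p).1 / (1 + (set_val p).2))].

Definition total_atlas (X : topologicalType) (E : Type)
    (Y : set (X * circle R)) (A : set (chart X E)) : set (chart Y (E * R)) :=
  open_subatlas Y (prod_atlas A circle_atlas).

Definition has_flow_box (Y : topologicalType) (F : Y * R -> Y) (y : Y) :=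
  exists (T : topologicalType) (U : set Y) (phi : Y -> T * R),
    flow_box_chart F y U phi.

Definition has_Cr_flow_box (r : smoothness) (Y : topologicalType)
    (E : normedModType R) (A : set (chart Y E)) (F : Y * R -> Y) (y : Y) :=
  exists (T : topologicalType) (m : nat) (AT : set (chart T 'rV[R]_m))
         (U : set Y) (phi : Y -> T * R),
    [/\ Cr_atlas r AT,
        flow_box_chart F y U phi
      & Cr_open_embedding r A (prod_atlas AT line_atlas) U phi].

End Smooth.
Arguments open_subatlas [M E] Y A.
Arguments total_atlas {R} [X E] Y A.

(* Main.v *)
Require Import Defs.
From HB Require Import structures.
From mathcomp Require Import all_boot all_order all_algebra.
From mathcomp Require Import all_classical all_reals all_analysis.
From mathcomp Require Import ring lra zify.

Import Order.TTheory GRing.Theory Num.Theory.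
Import numFieldNormedType.Exports.

Local Open Scope classical_set_scope.
Local Open Scope ring_scope.

(* In the angle coordinate, [h] over a full fibre lifts to a decreasing map [G]
   with [G (s + 2 pi) = G s - 2 pi]. The square [G \o G] does not depend on the
   lift and has a fixed point, so [G (G s)] is a distinguished lift of [h^2], at
   distance less than [2 pi] from [s]; [alpha] is the time the flow needs to go
   from [s] to it along the fibre. Over another fibre the leaves are open arcs,
   and [h^2] must be shown to preserve each of them, compatibly with the nearby
   full fibres. There are finitely many arcs, so some iterate [(G \o G)^n] brings
   a point [s] back to its arc up to a translation by [2 pi m], and the same
   iterate brings [G (G s)] back to its arc up to the same translation because
   [G] reverses translations twice; as [G \o G] is increasing and moves points by
   less than [2 pi], [s] and [G (G s)] lie in the same arc. Continuity and
   smoothness of [alpha] are read in flow boxes, where arrival times are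
   differences of the flow coordinate. *)

(** * Angles on the circle *)

(** [G \o G] ignores the choice of the lift because degree -1 turns an inner translation by [2 pi m]
    into [- 2 pi m], which cancels the outer one; it has a fixed point because [G s - s] changes
    sign, so that [G] has one. These fixed points also carry uniqueness: over a full fibre the flow
    is periodic and times are known only up to a period, but [alpha] must vanish at a fixed point of
    [h], continuity propagates the value around the circle, and density does the rest. The obstacle
    is a fibre that is not full: it has no lift, and the lifts over nearby full fibres are
    uncontrolled across its gaps. No limit of lifts is taken; the statements hold for every lift
    over every full fibre nearby and speak of points in a common arc of the limit fibre. An arc is
    shorter than [2 pi], so two translates of one angle never lie in the same arc, and this makes
    windings readable. Periodicity also keeps the flow alone from defining travel times. They come
    from flow coordinates glued along angle segments; two continuous choices agree because flow
    boxes exclude short periods. *)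

Section CircleAngles.
Context {R : realType}.
Implicit Types (s t u : R) (m n : int) (z : circle R).

Lemma expi_eq s t : cos s = cos t -> sin s = sin t -> expi s = expi t.
Proof. by move=> cst sst; apply/val_inj; rewrite /= cst sst. Qed.

Lemma circleP z : (val z).1 ^+ 2 + (val z).2 ^+ 2 = 1.
Proof. exact: set_mem (valP z). Qed.

Lemma cosD2pin (n : nat) t : cos (t + n%:R * (2 * pi)) = cos t.
Proof.
elim: n t => [|n IH] t; first by rewrite mul0r addr0.
rewrite -natr1 mulrDl mul1r addrA.
by rewrite [2 * pi in X in _ + X]mulr_natl cosD2pi IH.
Qed.

Lemma sinD2pin (n : nat) t : sin (t + n%:R * (2 * pi)) = sin t.
Proof.
elim: n t => [|n IH] t; first by rewrite mul0r addr0.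
rewrite -natr1 mulrDl mul1r addrA.
by rewrite [2 * pi in X in _ + X]mulr_natl sinD2pi IH.
Qed.

Lemma expiD2pi t m : expi (t + m%:~R * (2 * pi)) = expi t.
Proof.
case: m => n; first by apply: expi_eq; rewrite ?cosD2pin ?sinD2pin.
rewrite NegzE mulrNz mulNr.
have h u : u = (u - n.+1%:R * (2 * pi)) + n.+1%:R * (2 * pi) by rewrite subrK.
apply: expi_eq.
- by rewrite [in RHS](h t) cosD2pin.
- by rewrite [in RHS](h t) sinD2pin.
Qed.

Let pi0 : 0 < pi :> R. Proof. exact: pi_gt0. Qed.

Lemma mod2pi t u : exists m, u <= t + m%:~R * (2 * pi) < u + 2 * pi.
Proof.
have p2 : 0 < 2 * pi :> R by rewrite mulr_gt0.
exists (- Num.floor ((t - u) / (2 * pi))).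
have := floor_itv ((t - u) / (2 * pi)) => /andP[].
rewrite ler_pdivlMr // ltr_pdivrMr // intrD mulrDl => h1 h2.
rewrite mulrNz mulNr; apply/andP; split; lra.
Qed.

Lemma expi_eqP s t : expi s = expi t -> exists m, s = t + m%:~R * (2 * pi).
Proof.
move=> st; have [m /andP[m0 m1]] := mod2pi s t; exists (- m).
set d := s + m%:~R * (2 * pi) - t.
have cs : cos s = cos t by have /(congr1 (fun z => (val z).1)) := st.
have ss : sin s = sin t by have /(congr1 (fun z => (val z).2)) := st.
have cs' : cos (s + m%:~R * (2 * pi)) = cos s.
  by have /(congr1 (fun z => (val z).1)) := expiD2pi s m.
have ss' : sin (s + m%:~R * (2 * pi)) = sin s.
  by have /(congr1 (fun z => (val z).2)) := expiD2pi s m.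
have cd : cos d = 1 by rewrite cosB cs' ss' cs ss -!expr2 cos2Dsin2.
have sd : sin d = 0 by rewrite sinB cs' ss' cs ss mulrC subrr.
have [d0 d2] : 0 <= d /\ d < 2 * pi by split; rewrite /d; lra.
(* Here [cos d = 1] and [sin d = 0] with [0 <= d < 2 pi]; the sign of [sin] on each open half period
   and [cos pi = -1] leave only [d = 0]. *)
suff d00 : d = 0 by rewrite mulrNz mulNr; move: d00; rewrite /d; lra.
apply/eqP; rewrite eq_le d0 andbT leNgt; apply/negP => dgt.
have [dlt|] := ltP d pi.
  by have := @sin_gt0_pi R d; rewrite dgt dlt sd ltxx => /(_ isT).
rewrite le_eqVlt => /orP[/eqP dpi|dpi].
  by move: cd; rewrite -dpi cospi; lra.
have := @sin_gt0_pi R (d - pi).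
have -> : 0 < d - pi < pi by apply/andP; split; lra.
by rewrite sinB sinpi cospi sd; move=> /(_ isT); lra.
Qed.

Lemma expi_surj z : exists s, expi s = z.
Proof.
have h := circleP z.
have h1 : -1 <= (val z).1 <= 1 by apply/andP; split; nra.
have [z2|z2] := leP 0 (val z).2.
- exists (acos (val z).1); apply/val_inj => /=.
  rewrite acosK ?in_itv //= sin_acos // [RHS]surjective_pairing; congr (_, _).
  by rewrite -h [_ + _ ^+ 2]addrC addrK sqrtr_sqr ger0_norm.
- exists (- acos (val z).1); apply/val_inj => /=.
  rewrite cosN sinN acosK ?in_itv //= sin_acos // [RHS]surjective_pairing.
  congr (_, _).
  by rewrite -h [_ + _ ^+ 2]addrC addrK sqrtr_sqr ltr0_norm // opprK.
Qed.

Lemma expi_continuous : continuous (@expi R).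
Proof.
apply: continuous_comp_initial => /= t.
apply: (@cvg_pair _ _ _ _ (nbhs (cos t)) (nbhs (sin t))).
- exact: continuous_cos.
- exact: continuous_sin.
Qed.

(* The angle of [z] relative to [u]; meaningful only on [half_circle u]. *)
Definition angle u z := asin ((val z).2 * cos u - (val z).1 * sin u).
(** For [z = expi v] the condition reads [cos (v - u) > 0]; there [sin (v - u)] stays strictly
    between the end points of the domain of [asin]. *)
Definition half_circle u : set (circle R) :=
  [set z | 0 < (val z).1 * cos u + (val z).2 * sin u].

Lemma half_circle_sin u z : half_circle u z ->
  -1 < (val z).2 * cos u - (val z).1 * sin u < 1.
Proof.
rewrite /half_circle /= => hz; have h := circleP z; have h' := cos2Dsin2 u.
have : ((val z).2 * cos u - (val z).1 * sin u) ^+ 2 +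
       ((val z).1 * cos u + (val z).2 * sin u) ^+ 2 = 1.
  transitivity ((((val z).1) ^+ 2 + (val z).2 ^+ 2) * (cos u ^+ 2 + sin u ^+ 2)).
    by ring.
  by rewrite h h' mulr1.
by move: hz; move: (_ + _ * sin u) (_ - _) => a b a0 ab; apply/andP; split; nra.
Qed.

Lemma angleK u z : half_circle u z -> expi (u + angle u z) = z.
Proof.
move=> hz; have /andP[b1 b2] := half_circle_sin u z hz.
have h := circleP z; have h' := cos2Dsin2 u.
have b : -1 <= (val z).2 * cos u - (val z).1 * sin u <= 1 by rewrite !ltW.
have ca : cos (angle u z) = (val z).1 * cos u + (val z).2 * sin u.
  rewrite /angle cos_asin //; apply/eqP; rewrite -(@eqrXn2 _ 2) ?sqrtr_ge0 //.
  - rewrite sqr_sqrtr; last by rewrite subr_ge0; nra.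
    apply/eqP; transitivity ((((val z).1) ^+ 2 + (val z).2 ^+ 2) *
      (cos u ^+ 2 + sin u ^+ 2) - ((val z).2 * cos u - (val z).1 * sin u)^+2).
    by rewrite h h' mulr1.
    by ring.
  - exact: ltW.
have sa : sin (angle u z) = (val z).2 * cos u - (val z).1 * sin u.
  by rewrite /angle asinK // in_itv.
apply/val_inj; rewrite /= [RHS]surjective_pairing; congr (_, _).
- rewrite cosD ca sa.
  transitivity ((val z).1 * (cos u ^+ 2 + sin u ^+ 2)); first by ring.
  by rewrite h' mulr1.
- rewrite sinD ca sa.
  transitivity ((val z).2 * (cos u ^+ 2 + sin u ^+ 2)); first by ring.
  by rewrite h' mulr1.
Qed.

Let val_cont : continuous (val : circle R -> R * R).
Proof. exact: initial_continuous. Qed.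

Lemma circle1_cont : continuous (fun z : circle R => (val z).1).
Proof.
move=> z; have /= := (continuous_comp (@val_cont z) (@cvg_fst _ _ _ _ _)); exact.
Qed.

Lemma circle2_cont : continuous (fun z : circle R => (val z).2).
Proof.
move=> z; have /= := (continuous_comp (@val_cont z) (@cvg_snd _ _ _ _ _)); exact.
Qed.

Lemma half_circle_id u : half_circle u (expi u).
Proof. by rewrite /half_circle /= -!expr2 cos2Dsin2. Qed.

Lemma angle_id u : angle u (expi u) = 0.
Proof.
rewrite /angle /= mulrC subrr -[X in asin X]sin0 sinK //.
by rewrite in_itv /= oppr_le0 divr_ge0 // ltW.
Qed.

Lemma half_circle_open u : open (half_circle u).
Proof.
pose f z : R := (val z).1 * cos u + (val z).2 * sin u.
have cf : continuous f.
  move=> z; have c := @cst_continuous (circle R) R.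
  exact: (continuousD (continuousM (circle1_cont z) (c (cos u) z))
                      (continuousM (circle2_cont z) (c (sin u) z))).
rewrite (_ : half_circle u = f @^-1` [set t | 0 < t]) //.
by apply: open_comp; [move=> z _; exact: cf | exact: open_gt].
Qed.

Lemma angle_cont u z : half_circle u z -> {for z, continuous (angle u)}.
Proof.
move=> hz; rewrite /angle.
apply: (@continuous_comp _ _ _ (fun z : circle R =>
  (val z).2 * cos u - (val z).1 * sin u) asin).
  apply: continuousB; apply: continuousM; try exact: cst_continuous.
  - exact: circle2_cont.
  - exact: circle1_cont.
by apply: continuous_asin; exact: half_circle_sin.
Qed.

(** Near [expi u] the map [u + angle u z] is a continuous section of [expi]. *)
Lemma expi_open u (P : set R) : (\forall s \near u, P s) ->
  \forall z \near expi u, exists2 s, P s & expi s = z.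
Proof.
move=> Pu.
have c : (fun z => u + angle u z) @ expi u --> u.
  rewrite -[X in _ --> X]addr0 -[X in _ + X](angle_id u).
  by apply: (@cvgD _ _ _ (nbhs (expi u))); [exact: cvg_cst | exact/angle_cont/half_circle_id].
have {}c := c P Pu.
near=> z; exists (u + angle u z); first by near: z.
by apply: angleK; near: z; apply: open_nbhs_nbhs; split;
  [exact: half_circle_open|exact: half_circle_id].
Unshelve. all: by end_near. Qed.

End CircleAngles.

(** * Segments of the real line *)

Section RealLine.
Context {R : realType}.
Implicit Types (a b s t u v : R) (f g : R -> R).

Lemma itv_convex a b s t u : a <= s <= b -> a <= t <= b -> s <= u <= t ->
  a <= u <= b.
Proof.
by move=> /andP[h1 _] /andP[_ h2] /andP[h3 h4]; rewrite (le_trans h1) //= (le_trans h4).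
Qed.

(** Take the supremum of the points reachable from [a]: the local hypothesis there both reaches it
    and passes beyond it. This stands in for compactness and connectedness of a segment wherever
    local pieces are glued. *)
Lemma segment_chain (S : R -> R -> Prop) a b : a <= b ->
  (forall s t u, S s t -> S t u -> S s u) ->
  (forall c, a <= c <= b -> exists2 r, 0 < r & forall s t,
     a <= s -> s <= t -> t <= b -> `|s - c| < r -> `|t - c| < r -> S s t) ->
  S a b.
Proof.
move=> ab Str Sloc; pose A := [set c | a <= c <= b /\ S a c].
have Aa : A a.
  have [|r r0 Sr] := Sloc a; first by rewrite lexx.
  by split; [rewrite lexx | apply: Sr => //; rewrite subrr normr0].
have supA : has_sup A by split; [exists a | exists b => c [/andP[]]].
have [a_s s_b] : a <= sup A /\ sup A <= b.
  split; first exact: (ub_le_sup supA.2).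
  by apply: ge_sup => [|c [/andP[]]//]; exists a.
have [|r r0 Sr] := Sloc (sup A); first by rewrite a_s.
have [c [/andP[ac cb] Sac] sc] := sup_adherent r0 supA.
have cs : c <= sup A by apply: (ub_le_sup supA.2); split => //; rewrite ac.
have Sas : S a (sup A).
  apply: Str Sac _; apply: Sr => //; rewrite ?subrr ?normr0 //.
  by rewrite ltr_distl sc /= (le_lt_trans cs) // ltrDl.
have [sb|bs] := ltP (sup A) b; last first.
  by rewrite (_ : b = sup A) //; apply: le_anti; rewrite bs.
pose d := Num.min b (sup A + r / 2).
have sd : sup A < d by rewrite /d lt_min sb; lra.
suff : d <= sup A by rewrite leNgt sd.
apply: (ub_le_sup supA.2); split.
  by rewrite (le_trans a_s (ltW sd)) /d ge_min lexx.
apply: Str Sas _; apply: Sr => //.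
- exact: ltW.
- by rewrite /d ge_min lexx.
- by rewrite subrr normr0.
- rewrite gtr0_norm ?subr_gt0 // ltrBlDl.
  by apply: (@le_lt_trans _ _ (sup A + r / 2)); [rewrite /d ge_min lexx orbT | lra].
Qed.

Lemma continuous_ivt f a b v : continuous f -> a <= b ->
  Num.min (f a) (f b) <= v <= Num.max (f a) (f b) ->
  exists2 c, a <= c <= b & f c = v.
Proof.
move=> cf ab fv.
have [c] := @IVT R f a b v ab (continuous_subspaceT cf) fv.
by rewrite in_itv /= => cab fc; exists c.
Qed.

(** Values near two different multiples would force, by the intermediate value theorem, a value
    halfway between consecutive multiples, at distance at least [pi] from all of them; hence the
    bound [e <= pi]. *)
Lemma near_multiple_const f a b e : e <= pi -> continuous f -> a <= b ->
  (forall s, a <= s <= b -> exists m : int, `|f s - m%:~R * (2 * pi)| < e) ->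
  exists m : int, forall s, a <= s <= b -> `|f s - m%:~R * (2 * pi)| < e.
Proof.
move=> epi cf ab fm; have p0 := @pi_gt0 R.
have [|m fam] := fm a; first by rewrite lexx.
exists m => s /andP[as_ sb].
have [|k fsk] := fm s; first by rewrite as_.
have [->//|mk] := eqVneq m k.
have bad v : Num.min (f a) (f s) <= v <= Num.max (f a) (f s) ->
    exists j : int, `|v - j%:~R * (2 * pi)| < e.
  move=> /(continuous_ivt _ _ _ _ cf as_)[c /andP[ac cs] <-]; apply: fm.
  by rewrite ac (le_trans cs).
have nobad (i : int) :
    ~ (Num.min (f a) (f s) <= i%:~R * (2 * pi) + pi <= Num.max (f a) (f s)).
  move=> /bad[j]; have ij : (0 <= i - j) || (i - j <= -1) by lia.
  rewrite ltr_norml => /andP[h1 h2].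
  have e1 : i%:~R = (i - j)%:~R + j%:~R :> R by rewrite -intrD subrK.
  rewrite e1 in h1 h2; case/orP: ij => ij.
  - have : 0 <= (i - j)%:~R :> R by rewrite ler0z.
    by move=> h; nra.
  - have : (i - j)%:~R <= (-1)%:~R :> R by rewrite ler_int.
    by move=> h; nra.
move: fam fsk; rewrite !ltr_norml => /andP[a1 a2] /andP[s1 s2].
have [mk'|km] := ltP m k.
- case: (nobad m); have : (m + 1)%:~R <= k%:~R :> R by rewrite ler_int lezD1.
  rewrite intrD ge_min le_max => h.
  by apply/andP; split; apply/orP; [left|right]; nra.
- case: (nobad k); have : (k + 1)%:~R <= m%:~R :> R.
    by rewrite ler_int lezD1 lt_neqAle km andbT eq_sym.
  rewrite intrD ge_min le_max => h.
  by apply/andP; split; apply/orP; [right|left]; nra.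
Qed.

(* Points of [E] in the same component of [E]. *)
Definition tie (E : set R) a b :=
  forall s, Num.min a b <= s <= Num.max a b -> E s.

Lemma tie_eq E a b a' b' : tie E a b -> a = a' -> b = b' -> tie E a' b'.
Proof. by move=> t <- <-. Qed.

Lemma tieC E a b : tie E a b -> tie E b a.
Proof. by move=> t s; rewrite minC maxC; apply: t. Qed.

Lemma tie_sub E a b c d : tie E a b ->
  Num.min a b <= c <= Num.max a b -> Num.min a b <= d <= Num.max a b ->
  tie E c d.
Proof.
move=> tab /andP[ac cb] /andP[ad db] s /andP[h1 h2]; apply: tab.
apply/andP; split.
- by apply: le_trans h1; rewrite le_min ac.
- by apply: (le_trans h2); rewrite ge_max cb.
Qed.

Lemma tie_trans E b a c : tie E a b -> tie E b c -> tie E a c.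
Proof.
move=> tab tbc s; rewrite ge_min le_max => /andP[h1 h2].
have [sb|bs] := leP s b.
- have [as_|sa] := leP a s; first by apply: tab; rewrite ge_min le_max as_ sb orbT.
  move: h1; rewrite leNgt sa /= => cs.
  by apply: tbc; rewrite ge_min le_max cs sb orbT.
- have [as_|sa] := leP s a; first by apply: tab; rewrite ge_min le_max as_ (ltW bs) orbT.
  move: h2; rewrite [s <= a]leNgt sa /= => cs.
  by apply: tbc; rewrite ge_min le_max cs (ltW bs) orbT.
Qed.

Lemma tie_l E a b : tie E a b -> E a.
Proof. by apply; rewrite ge_min le_max lexx. Qed.

Lemma tie_r E a b : tie E a b -> E b.
Proof. by apply; rewrite ge_min le_max lexx !orbT. Qed.

Lemma tie_refl E a : E a -> tie E a a.
Proof. by move=> Ea s; rewrite minxx maxxx => /le_anti <-. Qed.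

Lemma tie_ball E a r : (forall s, `|s - a| < r -> E s) ->
  forall s t, `|s - a| < r -> `|t - a| < r -> tie E s t.
Proof.
move=> Er s t; rewrite !ltr_distl => /andP[s1 s2] /andP[t1 t2] u /andP[u1 u2].
apply: Er; rewrite ltr_distl; apply/andP; split.
- by apply: lt_le_trans u1; rewrite lt_min s1.
- by apply: (le_lt_trans u2); rewrite gt_max s2.
Qed.

Lemma int_mul_cases (m : int) (p : R) : 0 < p ->
  [\/ m%:~R * p <= - p, m = 0 | p <= m%:~R * p].
Proof.
move=> p0; have [m0|m0|->] := ltgtP m 0; [constructor 1|constructor 3|constructor 2] => //.
- have h : m%:~R <= (-1)%:~R :> R by rewrite ler_int; lia.
  by have := ler_wpM2r (ltW p0) h; rewrite mulrN1z mulN1r.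
- have h : 1%:~R <= m%:~R :> R by rewrite ler_int; lia.
  by have := ler_wpM2r (ltW p0) h; rewrite mul1r.
Qed.

Lemma int_mul_small (m : int) (p : R) : 0 < p -> `|m%:~R * p| < p -> m = 0.
Proof.
by move=> p0; rewrite ltr_norml => /andP[? ?]; case: (int_mul_cases m p p0) => // ?; exfalso; lra.
Qed.

(* The order argument: [c] and [d] are the images of [a] and [b] under an
   iterate of an increasing map sending [a] to [b], up to the period [p]. *)
Lemma tie_order E (p : R) (m : int) a b c d : 0 < p ->
  (forall s t, tie E s t -> `|s - t| < p) ->
  tie E a (c - m%:~R * p) -> tie E b (d - m%:~R * p) ->
  (a < b -> b <= c /\ c <= d) -> (b < a -> c <= b /\ d <= c) ->
  a - p <= d <= a + p ->
  tie E a b.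
Proof.
move=> p0 short ac bd up down /andP[d1 d2].
have := short _ _ ac; rewrite ltr_norml => /andP[ac1 ac2].
have := int_mul_cases m p p0.
have [ab|ba|<- _] := ltgtP a b; last by (apply: tie_refl; exact: tie_l ac).
(* A negative [m] would put [c - m p] farther than [p] from [a], against [short]. For [m = 0] the
   point [b] lies between [a] and [c]; for positive [m] the bound on [d] puts [a] between [d - m p]
   and [b]. The case [b < a] is the mirror image. *)
- have [bc cd] := up ab; case=> [m1|m0|m1].
  + by exfalso; lra.
  + move: ac; rewrite m0 mul0r subr0 => ac.
    apply: tie_sub ac _ _; rewrite ?ge_min ?le_max ?lexx //.
    by rewrite bc (ltW ab) orbT.
  + apply: tieC; apply: tie_sub bd _ _; rewrite ?ge_min ?le_max ?lexx //.
    by rewrite (ltW ab) /= andbT; apply/orP; right; lra.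
- have [cb dc] := down ba; case=> [m1|m0|m1].
  + apply: tieC; apply: tie_sub bd _ _; rewrite ?ge_min ?le_max ?lexx //.
    by rewrite (ltW ba) /=; apply/orP; right; lra.
  + move: ac; rewrite m0 mul0r subr0 => ac.
    apply: tie_sub ac _ _; rewrite ?ge_min ?le_max ?lexx //.
    by rewrite cb (ltW ba) orbT.
  + by exfalso; lra.
Qed.

(** Supplies the order hypotheses of [tie_order]: under a nondecreasing map an orbit keeps the
    direction of its first step. [n] is positive because the comparison starts at [f a]. *)
Lemma iter_homo (f : R -> R) a n : {homo f : s t / s <= t} -> (0 < n)%N ->
  (a <= f a -> f a <= iter n f a <= iter n.+1 f a) /\
  (f a <= a -> iter n.+1 f a <= iter n f a <= f a).
Proof.
case: n => // n hf _; split=> af; elim: n => [|n /andP[h1 h2]] /=.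
- by rewrite lexx hf.
- by rewrite (le_trans h1 h2) hf.
- by rewrite lexx hf.
- by rewrite (le_trans h1 h2) hf // andbT.
Qed.

End RealLine.

(** * Neighbourhoods in products with the line *)

Lemma nbhs_pair_ball {R : realType} {X : topologicalType} (x : X) (c : R)
    (P : set (X * R)) : nbhs (x, c) P ->
  exists N r, [/\ nbhs x N, 0 < r
    & forall x' s, N x' -> `|s - c| < r -> P (x', s)].
Proof.
case=> -[A B] /= [Ax /nbhs_ballP[r /= r0 Br]] ABP; exists A, r; split=> //.
by move=> x' s Ax' sr; apply: ABP; split=> //; apply: Br; rewrite /ball /= distrC.
Qed.

Lemma nbhs_dist_ball {R : realType} (c : R) (P : set R) : nbhs c P ->
  exists2 r, 0 < r & forall s, `|s - c| < r -> P s.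
Proof.
move=> /nbhs_ballP[r /= r0 Br]; exists r => // s sr.
by apply: Br; rewrite /ball /= distrC.
Qed.

Lemma dist_ball_nbhs {R : realType} (c r : R) (P : set R) : 0 < r ->
  (forall s, `|s - c| < r -> P s) -> nbhs c P.
Proof.
move=> r0 Br; apply/nbhs_ballP; exists r => // s.
by rewrite /ball /= distrC; apply: Br.
Qed.

(** Tube lemma, by compactness of the segment. *)
Lemma near_segment {R : realType} {X : topologicalType} (x0 : X) (a b : R)
    (P : X -> R -> Prop) :
  (forall c, a <= c <= b -> exists N r, [/\ nbhs x0 N, 0 < r
     & forall x s, N x -> `|s - c| < r -> P x s]) ->
  nbhs x0 [set x | forall s, a <= s <= b -> P x s].
Proof.
move=> hP; have cov : forall c, `[a, b]%classic c ->
    \forall s \near c & x \near x0, P x s.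
  move=> c; rewrite /= in_itv /= => /hP[N [r [Nx r0 hN]]].
  exists ([set s | `|s - c| < r], N) => /=.
    by split=> //; exact: (dist_ball_nbhs _ r).
  by move=> [s x] [/= sr Nx']; exact: hN.
have h := (compact_near_coveringP _).1 (@segment_compact R a b) X (nbhs x0)
  (fun x s => P x s) _ cov.
have h' : nbhs x0 (fun x => `[a, b]%classic `<=` P x) by exact: h.
by apply: (@filterS _ (nbhs x0) _ _ _ _ h') => x hx s sab; apply: hx; rewrite /= in_itv.
Qed.

Lemma nbhs_pairl {S T : topologicalType} (x : S) (t : T) (P : set (S * T)) :
  nbhs (x, t) P -> nbhs t [set u | P (x, u)].
Proof.
case=> -[A B] /= [Ax Bt] AB; apply: (@filterS _ (nbhs t) _ _ _ _ Bt) => u Bu.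
by apply: AB; split=> //; exact: nbhs_singleton Ax.
Qed.

Lemma nbhs_pairr {S T : topologicalType} (x : S) (t : T) (P : set (S * T)) :
  nbhs (x, t) P -> nbhs x [set y | P (y, t)].
Proof.
case=> -[A B] /= [Ax Bt] AB; apply: (@filterS _ (nbhs x) _ _ _ _ Ax) => u Bu.
by apply: AB; split=> //; exact: nbhs_singleton Bt.
Qed.

Lemma continuous_dist {R : realType} {T : topologicalType} (f : T -> R) t e :
  {for t, continuous f} -> 0 < e -> nbhs t [set s | `|f s - f t| < e].
Proof.
move=> cf e0; apply: (cf [set v | `|v - f t| < e]).
exact: (dist_ball_nbhs _ e).
Qed.

Section Clamp.
Context {R : realType}.
Implicit Types (a b t : R).

Lemma maxr_continuous a : continuous (fun t => Num.max t a).
Proof.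
move=> t P /nbhs_dist_ball[r r0 rP]; apply: (dist_ball_nbhs _ r) => // s sr.
apply: rP; apply: le_lt_trans sr; rewrite /=.
have [sa|sa] := leP s a; have [ta|ta] := leP t a;
  rewrite ?subrr ?normr0 // ler_norml; apply/andP; split;
  have := ler_norm (s - t); have := ler_norm (t - s); rewrite (distrC t); lra.
Qed.

Lemma minr_continuous a : continuous (fun t => Num.min t a).
Proof.
move=> t P /nbhs_dist_ball[r r0 rP]; apply: (dist_ball_nbhs _ r) => // s sr.
apply: rP; apply: le_lt_trans sr; rewrite /=.
have [sa|sa] := leP s a; have [ta|ta] := leP t a;
  rewrite ?subrr ?normr0 // ler_norml; apply/andP; split;
  have := ler_norm (s - t); have := ler_norm (t - s); rewrite (distrC t); lra.
Qed.

(** Retraction of the line onto [[a, b]]: it turns a function continuous only along a segment into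
    one continuous everywhere, as [timing] requires. *)
Definition clamp a b t := Num.max (Num.min t b) a.

Lemma clamp_itv a b t : a <= b -> a <= clamp a b t <= b.
Proof.
by move=> ab; rewrite /clamp le_max lexx orbT ge_max ge_min lexx orbT.
Qed.

Lemma clampE a b t : a <= t <= b -> clamp a b t = t.
Proof.
by move=> /andP[ta tb]; rewrite /clamp (min_idPl tb) (max_idPl ta).
Qed.

Lemma clamp_continuous a b : continuous (clamp a b).
Proof.
move=> t; apply: (@continuous_comp _ _ _ (fun t => Num.min t b)
  (fun t => Num.max t a)); [exact: minr_continuous|exact: maxr_continuous].
Qed.

End Clamp.

(** * Flow boxes and travel times *)

Section FibredFlow.
Context {R : realType} {X : topologicalType} (Y : set (X * circle R)) (yd : Y).
Implicit Types (x : X) (s t u : R) (y : Y).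

Definition base y : X := (set_val y).1.

(* [yd] is a junk value, used off [Y]. *)
Definition pt x s : Y := insubd yd (x, expi s).

Definition angles x : set R := [set s | Y (x, expi s)].

Lemma val_pt x s : angles x s -> set_val (pt x s) = (x, expi s).
Proof. by move=> h; rewrite set_valE val_insubd mem_set. Qed.

Lemma base_pt x s : angles x s -> base (pt x s) = x.
Proof. by move=> h; rewrite /base val_pt. Qed.

Lemma pt_eq y x s : set_val y = (x, expi s) -> angles x s /\ y = pt x s.
Proof.
move=> ys; have a : angles x s by rewrite /angles /= -ys; exact: set_valP.
by split=> //; apply: val_inj; rewrite -!set_valE val_pt.
Qed.

Lemma ptP y : exists2 s, angles (base y) s & y = pt (base y) s.
Proof.
have [s es] := expi_surj (set_val y).2.
have [] := @pt_eq y (base y) s; last by exists s.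
by rewrite es /base -surjective_pairing.
Qed.

Lemma angles_shift x s (m : int) :
  angles x (s + m%:~R * (2 * pi)) <-> angles x s.
Proof. by rewrite /angles /= expiD2pi. Qed.

Lemma pt_shift x s (m : int) : pt x (s + m%:~R * (2 * pi)) = pt x s.
Proof. by rewrite /pt expiD2pi. Qed.

Lemma pt_inj x s t : angles x s -> angles x t -> pt x s = pt x t ->
  exists m : int, s = t + m%:~R * (2 * pi).
Proof.
move=> /val_pt vs /val_pt vt st; apply: expi_eqP.
by have := vs; rewrite st vt => /(congr1 snd).
Qed.

Lemma tie_shift x s t (m : int) : tie (angles x) s t ->
  tie (angles x) (s + m%:~R * (2 * pi)) (t + m%:~R * (2 * pi)).
Proof.
move=> st u; rewrite -addr_minl -addr_maxl => /andP[h1 h2].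
have := st (u - m%:~R * (2 * pi)); rewrite -(angles_shift _ _ m) subrK.
by apply; apply/andP; split; lra.
Qed.

Hypothesis openY : open Y.

Let pair_cont x s : (fun q : X * R => (q.1, expi q.2)) @ (x, s) --> (x, expi s).
Proof.
apply: (@cvg_pair _ _ _ _ (nbhs x) (nbhs (expi s))); first exact: cvg_fst.
apply: (@cvg_comp _ _ _ snd (@expi R)); first exact: cvg_snd.
exact: expi_continuous.
Qed.

Lemma angles_open x s : angles x s ->
  \forall q \near (x, s), angles q.1 q.2.
Proof.
by move=> h; apply: (pair_cont x s Y); apply: open_nbhs_nbhs.
Qed.

Lemma nbhs_val y (P : set Y) : nbhs y P <->
  exists2 W, nbhs (set_val y) W & forall z, W (set_val z) -> P z.
Proof.
split.
  case=> _ [] [W oW <-] Wy WP; exists W; first exact: open_nbhs_nbhs.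
  by move=> z Wz; apply: WP.
case=> W Wy WP; have h := @initial_continuous _ _ (set_val : Y -> _) y _ Wy.
exact: (@filterS _ (nbhs y) _ _ _ WP h).
Qed.

Lemma pt_cont x s : angles x s ->
  {for (x, s), continuous (fun q : X * R => pt q.1 q.2)}.
Proof.
move=> h P /nbhs_val [W]; rewrite val_pt // => /pair_cont WP PW.
rewrite nbhs_filterE /=.
apply: (@filterS2 _ (nbhs (x, s)) _ _ _ _ _ (angles_open _ _ h) WP) => q a Wq.
by apply: PW; rewrite val_pt.
Qed.

Lemma near_pt x u (P : set (X * R)) : angles x u ->
  (\forall q \near (x, u), P q) ->
  \forall y \near pt x u, exists s,
    [/\ angles (base y) s, y = pt (base y) s & P (base y, s)].
Proof.
move=> h [] [A B] /= [Ax Bu] ABP; apply/nbhs_val; rewrite val_pt //.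
exists (A `*` [set z | exists2 s, B s & expi s = z]).
  by exists (A, [set z | exists2 s, B s & expi s = z]) => //; split => //; exact: expi_open.
move=> y [/= Ay [s Bs es]]; exists s.
have [|ha hy] := @pt_eq y (base y) s; first by rewrite es /base -surjective_pairing.
by split=> //; apply: ABP.
Qed.

Context (F : Y * R -> Y).
Hypotheses (flowF : is_flow F)
  (base_flow : forall y t, base (F (y, t)) = base y).
Implicit Types (a b c d e r : R) (T : R -> R).

Lemma flow0 y : F (y, 0) = y. Proof. by case: flowF. Qed.

Lemma flowD y s t : F (F (y, t), s) = F (y, s + t).
Proof. by case: flowF. Qed.

Lemma flowNK y t : F (F (y, t), - t) = y.
Proof. by rewrite flowD addNr flow0. Qed.

Lemma flow_inj y t u : F (y, t) = F (y, u) -> F (y, u - t) = y.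
Proof. by move=> tu; rewrite addrC -flowD -tu flowNK. Qed.

Lemma flow_cont_t y : continuous (fun t => F (y, t)).
Proof.
move=> t; have [cF _ _] := flowF.
apply: (@continuous_comp _ _ _ (fun t => (y, t)) F); last exact: cF.
by move=> P; exact: nbhs_pairl.
Qed.

Lemma flow_cont_y t : continuous (fun y => F (y, t)).
Proof.
move=> y; have [cF _ _] := flowF.
apply: (@continuous_comp _ _ _ (fun y => (y, t)) F); last exact: cF.
by move=> P; exact: nbhs_pairr.
Qed.

(* In the leaf of dimension 1 a short orbit arc is a neighbourhood of its
   midpoint, by the intermediate value theorem. *)
Lemma orbit_nbhs x s e : angles x s -> 0 < e ->
  (forall t t', `|t| < e -> `|t'| < e ->
     F (pt x s, t) = F (pt x s, t') -> t = t') ->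
  \forall s' \near s, exists2 t, `|t| < e & F (pt x s, t) = pt x s'.
Proof.
move=> xs e0 Finj; pose g t : circle R := (set_val (F (pt x s, t))).2.
have cg : continuous g.
  move=> t; apply: (@continuous_comp _ _ _ (fun t => F (pt x s, t))
    (fun y : Y => (set_val y).2)); first exact: flow_cont_t.
  apply: (@continuous_comp _ _ _ (set_val : Y -> _) snd).
  - exact: initial_continuous.
  - exact: cvg_snd.
have g0 : g 0 = expi s by rewrite /g flow0 val_pt.
have [d' d'0 hd'] : exists2 r, 0 < r & forall t, `|t - 0| < r -> half_circle s (g t).
  apply: nbhs_dist_ball; apply: (cg 0); rewrite g0.
  by apply: open_nbhs_nbhs; split; [exact: half_circle_open|exact: half_circle_id].
pose d := Num.min d' e / 2.
have d0 : 0 < d by rewrite divr_gt0 // lt_min d'0.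
have [dd' de] : d < d' /\ d < e.
  by rewrite /d !ltr_pdivrMr // !gt_min; split; apply/orP; [left|right]; lra.
pose th t := angle s (g t).
have hd t : -d <= t <= d -> [/\ half_circle s (g t), `|t| < e
    & F (pt x s, t) = pt x (s + th t)].
  rewrite -ler_norml => td.
  have h : half_circle s (g t) by apply: hd'; rewrite subr0 (le_lt_trans td).
  split=> //; first exact: le_lt_trans td _.
  have [|//] := @pt_eq (F (pt x s, t)) x (s + th t).
  rewrite angleK // [LHS]surjective_pairing; congr (_, _).
  by have := base_flow (pt x s) t; rewrite base_pt.
have th0 : th 0 = 0 by rewrite /th g0 angle_id.
have cth : {within `[-d, d], continuous th}.
  apply: continuous_in_subspaceT => t; rewrite inE /= in_itv /= => td.
  have [h _ _] := hd t td.
  apply: (@continuous_comp _ _ _ g (angle s)); [exact: cg|exact: angle_cont].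
have ith : {in `[-d, d] &, injective th}.
  move=> t t'; rewrite !in_itv /= => /hd[_ te Ft] /hd[_ t'e Ft'] tt'.
  by apply: Finj => //; rewrite Ft Ft' tt'.
have [d1 d2 d3] : [/\ -d \in `[-d, d], 0 \in `[-d, d] & d \in `[-d, d]].
  by rewrite !in_itv /=; split; apply/andP; split; lra.
(* [th] is injective, hence strictly monotone on [[-d, d]], so [th 0 = 0] lies strictly between its
   two end values. *)
have [r r0 hr] : exists2 r, 0 < r & forall v, `|v| < r ->
    Num.min (th (-d)) (th d) <= v <= Num.max (th (-d)) (th d).
  have [inc|dec] := itv_continuous_inj_mono cth ith.
  - have h1 : th (-d) < 0 by rewrite -th0 inc //; lra.
    have h2 : 0 < th d by rewrite -th0 inc //; lra.
    exists (Num.min (- th (-d)) (th d)); first by rewrite lt_min; apply/andP; split; lra.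
    move=> v; rewrite lt_min !ltr_norml ge_min le_max => /andP[/andP[? ?] /andP[? ?]].
    by apply/andP; split; apply/orP; [left|right]; lra.
  - have h1 : 0 < th (-d) by rewrite -th0 dec //; lra.
    have h2 : th d < 0 by rewrite -th0 dec //; lra.
    exists (Num.min (th (-d)) (- th d)); first by rewrite lt_min; apply/andP; split; lra.
    move=> v; rewrite lt_min !ltr_norml ge_min le_max => /andP[/andP[? ?] /andP[? ?]].
    by apply/andP; split; apply/orP; [right|left]; lra.
apply: (dist_ball_nbhs _ r) => // s' /hr hs'.
have [|t] := @IVT _ th (-d) d _ _ cth hs'; first by lra.
rewrite in_itv /= => /hd[_ te Ft] tht; exists t => //.
by rewrite Ft tht addrC subrK.
Qed.

Section Chart.
Context (x0 : X) (c : R) (T : topologicalType) (U : set Y) (phi : Y -> T * R).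
Hypotheses (ac : angles x0 c) (box : flow_box_chart F (pt x0 c) U phi).

(** The chart controls [phi] only along the flow. Short orbit arcs are neighbourhoods in the leaf,
    so the transverse coordinate is locally constant in the angle, hence constant on a ball;
    injectivity of [phi] then gives the flow time as a difference of second coordinates. *)
Lemma flow_box_leaf : exists N r, [/\ nbhs x0 N, 0 < r
  & forall x s s', N x -> `|s - c| < r -> `|s' - c| < r ->
     [/\ angles x s, U (pt x s) &
     F (pt x s, (phi (pt x s')).2 - (phi (pt x s)).2) = pt x s']].
Proof.
have [_ Uy [oU cphi iphi _] [e [V [e0 oV Vy Vflow]]]] := box.
pose rho y := (phi y).2; pose zeta y := (phi y).1.
have crho : {for pt x0 c, continuous rho}.
  apply: (@continuous_comp _ _ _ phi snd); first exact: cphi.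
  exact: cvg_snd.
have a := angles_open _ _ ac.
(* With [e / 2], two second coordinates differ by less than the time [e] that the chart allows. *)
have hW : nbhs (pt x0 c) [set y | [/\ V y, U y & `|rho y - rho (pt x0 c)| < e / 2]].
  have h1 : nbhs (pt x0 c) V by apply: open_nbhs_nbhs.
  have h2 : nbhs (pt x0 c) U by apply: open_nbhs_nbhs.
  have h3 : nbhs (pt x0 c) [set y | `|rho y - rho (pt x0 c)| < e / 2].
    apply: (crho [set v | `|v - rho (pt x0 c)| < e / 2]).
    by apply: (dist_ball_nbhs _ (e / 2)) => //; rewrite divr_gt0.
  by apply: (@filterS3 _ (nbhs (pt x0 c)) _ _ _ _ _ _ h1 h2 h3).
have h := pt_cont _ _ ac _ hW.
have [N [r [Nx0 r0 hN]]] := nbhs_pair_ball x0 c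
  [set q | angles q.1 q.2 /\ [/\ V (pt q.1 q.2), U (pt q.1 q.2) &
     `|rho (pt q.1 q.2) - rho (pt x0 c)| < e / 2]]
  (@filterS2 _ (nbhs (x0, c)) _ _ _ _ (fun _ p q => conj p q) a h).
exists N, r; split=> // x s s' Nx sr s'r.
have ball_conv u t v : `|u - c| < r -> `|v - c| < r -> u <= t <= v -> `|t - c| < r.
  rewrite !ltr_distl => /andP[? ?] /andP[? ?] /andP[? ?].
  by apply/andP; split; lra.
have zeta_loc u : `|u - c| < r -> \forall v \near u,
    `|v - c| < r -> zeta (pt x v) = zeta (pt x u).
  move=> ur; have [au [Vu Uu _]] := hN x u Nx ur.
  have := @orbit_nbhs x u e au e0.
  have inj : forall t t', `|t| < e -> `|t'| < e ->
      F (pt x u, t) = F (pt x u, t') -> t = t'.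
    move=> t t'; rewrite !ltr_norml => /(Vflow _ _ Vu)[_ p] /(Vflow _ _ Vu)[_ p'] tt'.
    by move: p'; rewrite -tt' p => -[/addrI].
  move=> /(_ inj); apply: filterS => v [t]; rewrite ltr_norml => te vE vr.
  by rewrite -vE /zeta (Vflow _ _ Vu te).2.
have zeta_const u v : `|u - c| < r -> `|v - c| < r -> u <= v ->
    zeta (pt x u) = zeta (pt x v).
  move=> ur vr uv.
  apply: (segment_chain (fun a b => zeta (pt x a) = zeta (pt x b)) u v uv).
    by move=> ? ? ? ->.
  move=> w uwv; have wr := ball_conv _ _ _ ur vr uwv.
  have [d d0 hd] := nbhs_dist_ball _ _ (zeta_loc w wr); exists d => // p q up pq qv pd qd.
  have pr : `|p - c| < r by apply: (ball_conv u p v) => //; rewrite up (le_trans pq).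
  have qr : `|q - c| < r by apply: (ball_conv u q v) => //; rewrite qv (le_trans up).
  by rewrite hd // hd.
have zE : zeta (pt x s) = zeta (pt x s').
  by have [ss|/ltW ss] := leP s s'; [exact: zeta_const|apply/esym/zeta_const].
have [as_ [Vs Us es]] := hN x s Nx sr; have [as' [Vs' Us' es']] := hN x s' Nx s'r.
split=> //; have te : - e < rho (pt x s') - rho (pt x s) < e.
  move: es es'; rewrite !ltr_norml => /andP[? ?] /andP[? ?].
  by apply/andP; split; lra.
have [UF pF] := Vflow _ _ Vs te.
apply: iphi; rewrite ?inE // pF [RHS]surjective_pairing -/(zeta _) -/(rho _).
by rewrite -/(zeta _) -/(rho _) zE addrC subrK.
Qed.

(** A return within the time allowed by the chart would translate the second coordinate by [t] and
    yet fix it. *)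
Lemma flow_box_no_short_period : exists2 e, 0 < e &
  \forall y \near pt x0 c, forall t, `|t| < e -> F (y, t) = y -> t = 0.
Proof.
have [_ Uy [oU cphi iphi _] [e [V [e0 oV Vy Vflow]]]] := box.
exists e => //; have h1 : nbhs (pt x0 c) V by apply: open_nbhs_nbhs.
apply: (@filterS _ (nbhs (pt x0 c)) _ _ _ _ h1) => y Vy' t; rewrite ltr_norml => te Fy.
have [_] := Vflow _ _ Vy' te; rewrite Fy [LHS]surjective_pairing => -[].
by move/eqP; rewrite -subr_eq0 opprD addrA subrr add0r oppr_eq0 => /eqP.
Qed.

End Chart.

Hypothesis boxes : forall y, has_flow_box F y.

Lemma no_short_period x c : angles x c -> exists2 e, 0 < e &
  \forall y \near pt x c, forall t, `|t| < e -> F (y, t) = y -> t = 0.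
Proof.
by move=> xc; have [T [U [phi]]] := boxes (pt x c); exact: flow_box_no_short_period.
Qed.

(* The two times differ by a period, and there are no short periods. *)
Lemma arrival_rigid (a b : Y -> R) y :
  {for y, continuous a} -> {for y, continuous b} -> a y = b y ->
  (\forall z \near y, F (z, a z) = F (z, b z)) ->
  \forall z \near y, a z = b z.
Proof.
have [s xs ->] := ptP y; move: (base y) xs => x xs.
move=> ca cb ab; have [e e0 he] := no_short_period x s xs.
have cab : {for pt x s, continuous (fun z => b z - a z)}.
  exact: (@continuousB R R^o _ b a _ cb ca).
have := cab [set v | `|v - (b (pt x s) - a (pt x s))| < e].
move=> /(_ (dist_ball_nbhs _ e _ e0 (fun _ => id))) hab hF.
apply: (@filterS3 _ (nbhs (pt x s)) _ _ _ _ _ _ he hab hF) => z hz /=.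
rewrite ab subrr subr0 => hab' /flow_inj /(hz _ hab') /eqP.
by rewrite subr_eq0 => /eqP.
Qed.

(** A flow coordinate along an arc. On a periodic orbit the times between points are ambiguous;
    continuity of [T] removes the ambiguity, up to an additive constant. *)
Definition timing x a b T := continuous T /\
  forall s t, a <= s <= b -> a <= t <= b -> F (pt x s, T t - T s) = pt x t.

Lemma timing_sub x a b c d T : a <= c -> d <= b -> timing x a b T ->
  timing x c d T.
Proof.
move=> ac db [cT fT]; split=> // s t /andP[cs sd] /andP[ct td].
by apply: fT; apply/andP; split; lra.
Qed.

(** The sum is [T t + T' b] to the left of [b] and [T b + T' t] to its right; [min] and [max] make
    its continuity immediate. *)
Lemma timing_glue x a b c T T' : a <= b -> b <= c ->
  timing x a b T -> timing x b c T' ->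
  timing x a c (fun t => T (Num.min t b) + T' (Num.max t b)).
Proof.
move=> ab bc [cT fT] [cT' fT']; split.
  move=> t; apply: (@continuousD R R^o).
  - apply: (@continuous_comp _ _ _ (fun t => Num.min t b) T).
    exact: minr_continuous. exact: cT.
  - apply: (@continuous_comp _ _ _ (fun t => Num.max t b) T').
    exact: maxr_continuous. exact: cT'.
move=> s t /andP[as_ sc] /andP[at_ tc].
have Ft s' t' : a <= s' <= b -> a <= t' <= b -> F (pt x s', T t' - T s') = pt x t'.
  exact: fT.
have [sb|/ltW bs] := leP s b; have [tb|/ltW bt] := leP t b.
- by rewrite opprD addrACA subrr addr0 fT // ?as_ ?at_.
- rewrite opprD addrACA addrC -flowD fT ?as_ ?ab ?lexx //.
  by rewrite fT' ?lexx ?bc ?bt.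
- rewrite opprD addrACA -flowD fT' ?lexx ?bc ?bs //.
  by rewrite fT ?lexx ?ab ?at_.
- by rewrite opprD addrACA subrr add0r fT' // ?bs ?bt.
Qed.

(** One flow box coordinate [rho] times all fibres near [x0] at once, which later gives continuity
    across fibres; clamping the angle keeps it inside the chart. *)
Lemma local_timing x0 c : angles x0 c -> exists (rho : Y -> R) N r,
  [/\ nbhs x0 N, 0 < r & forall x, N x ->
    (forall s, `|s - c| < r -> angles x s /\
      {for (x, s), continuous (fun q : X * R => rho (pt q.1 q.2))}) /\
    forall s t, s <= t -> `|s - c| < r -> `|t - c| < r ->
      timing x s t (fun u => rho (pt x (clamp s t u)))].
Proof.
move=> a0; have [T [U [phi box]]] := boxes (pt x0 c).
have [N [r [N0 r0 hN]]] := flow_box_leaf _ _ _ _ _ a0 box.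
have [_ _ [_ cphi _ _] _] := box.
exists (fun y => (phi y).2), N, r; split; [exact: N0|exact: r0|move=> x Nx].
have hc : forall s, `|s - c| < r -> angles x s /\
    {for (x, s), continuous (fun q : X * R => (phi (pt q.1 q.2)).2)}.
  move=> s sr; have [xs Us _] := hN x s s Nx sr sr; split; first exact: xs.
  apply: (@continuous_comp _ _ _ (fun q : X * R => pt q.1 q.2) (fun y => (phi y).2)).
    exact: pt_cont.
  apply: (@continuous_comp _ _ _ phi snd); [exact: cphi|exact: cvg_snd].
split; [exact: hc|move=> s t st sr tr].
have conv u : s <= u <= t -> `|u - c| < r.
  move: sr tr; rewrite !ltr_distl => /andP[? ?] /andP[? ?] /andP[? ?].
  by apply/andP; split; lra.
split.
- move=> u; apply: (@continuous_comp _ _ _ (clamp s t) (fun u => (phi (pt x u)).2)).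
    exact: clamp_continuous.
  have [_ h] := hc _ (conv _ (clamp_itv s t u st)).
  apply: (@continuous_comp _ _ _ (fun u => (x, u))
    (fun q : X * R => (phi (pt q.1 q.2)).2)); last exact: h.
  by move=> P; exact: nbhs_pairl.
- move=> u v su sv; rewrite !clampE //.
  by have [_ _] := hN x u v Nx (conv _ su) (conv _ sv).
Qed.

Lemma timing_exists x a b : a <= b -> (forall s, a <= s <= b -> angles x s) ->
  exists T, timing x a b T.
Proof.
move=> ab xab.
apply: (segment_chain (fun s t => s <= t /\ exists T, timing x s t T) a b ab _ _).2.
- move=> s t u [st [T1 h1]] [tu [T2 h2]]; split; first exact: le_trans tu.
  by exists (fun w => T1 (Num.min w t) + T2 (Num.max w t)); exact: timing_glue.
- move=> c /xab/local_timing[rho [N [r [Nx r0 hN]]]]; exists r => // s t _ st _ sr tr.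
  have [_ h] := hN x (nbhs_singleton Nx).
  by split=> //; exists (fun u => rho (pt x (clamp s t u))); exact: h.
Qed.

(** The times given by two timings differ by a period, which is small over a short segment; as there
    are no short periods, [T - T'] is locally constant. *)
Lemma timing_unique x a b T T' s t : (forall s, a <= s <= b -> angles x s) ->
  timing x a b T -> timing x a b T' -> a <= s <= b -> a <= t <= b ->
  T t - T s = T' t - T' s.
Proof.
move=> xab [cT fT] [cT' fT'].
wlog st : s t / s <= t.
  move=> h sab tab; have [st|/ltW ts] := leP s t; first exact: h.
  by have := h t s ts tab sab; move/(congr1 -%R); rewrite !opprB.
move=> /andP[as_ sb] /andP[at_ tb].
suff : T s - T' s = T t - T' t by lra.
apply: (segment_chain (fun s t => T s - T' s = T t - T' t) s t st).
  by move=> ? ? ? ->.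
move=> c /andP[sc ct]; have cab : a <= c <= b by rewrite (le_trans as_) ?(le_trans ct).
have [e e0 he] := no_short_period _ _ (xab c cab).
(* Four values enter the discrepancy, each within [e / 4] of its value at [c]. *)
have e4 : 0 < e / 4 by rewrite divr_gt0.
have h1 := nbhs_pairl _ _ _ (pt_cont _ _ (xab c cab) _ he).
have h2 := continuous_dist T c _ (cT c) e4.
have h3 := continuous_dist T' c _ (cT' c) e4.
have [r r0 hr] := nbhs_dist_ball _ _
  (filterI h1 (filterI h2 h3)).
exists r => // u v su uv vt ur vr.
have [/= u1 [u2 u3]] := hr u ur; have [/= _ [v2 v3]] := hr v vr.
have uab : a <= u <= b by rewrite (le_trans as_) ?(le_trans uv) ?(le_trans vt).
have vab : a <= v <= b by rewrite (le_trans as_) ?(le_trans su) ?(le_trans vt).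
have := fT u v uab vab; rewrite -(fT' u v uab vab) => /flow_inj /u1.
suff uve : `|T' v - T' u - (T v - T u)| < e by move=> /(_ uve); lra.
clear -u2 u3 v2 v3; move: u2 u3 v2 v3; rewrite !ltr_norml.
move=> /andP[? ?] /andP[? ?] /andP[? ?] /andP[? ?].
by apply/andP; split; lra.
Qed.

(** [min] and [max] let one definition serve both directions along the fibre. The default [fun=> 0]
    is taken only when no timing exists, which cannot happen for tied [a] and [b]. *)
Definition travel x a b : R :=
  let T := xget (fun=> 0) [set T | timing x (Num.min a b) (Num.max a b) T] in
  T b - T a.

Lemma travelE x a b T s t : (forall s, a <= s <= b -> angles x s) ->
  timing x a b T -> a <= s <= b -> a <= t <= b -> travel x s t = T t - T s.
Proof.
move=> xab hT /andP[as_ sb] /andP[at_ tb]; rewrite /travel.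
have h : timing x (Num.min s t) (Num.max s t) T.
  by apply: timing_sub hT; rewrite ?le_min ?ge_max ?as_ ?sb.
case: xgetP => [T' _ hT'|/(_ T)//].
apply: timing_unique hT' h _ _; rewrite ?ge_min ?le_max ?lexx ?orbT //.
move=> u; rewrite ge_min le_max => /andP[/orP h1 /orP h2].
by apply: xab; apply/andP; split; [case: h1|case: h2] => h'; lra.
Qed.

Lemma tie_itv x a b : tie (angles x) a b ->
  exists lo hi, [/\ lo <= hi, forall s, lo <= s <= hi -> angles x s,
    lo <= a <= hi & lo <= b <= hi].
Proof.
move=> h; exists (Num.min a b), (Num.max a b); split=> //;
  by rewrite ?ge_min ?le_max ?lexx ?orbT.
Qed.

Lemma travelP x a b : tie (angles x) a b -> F (pt x a, travel x a b) = pt x b.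
Proof.
move=> /tie_itv[lo [hi [lohi h alh blh]]].
have [T hT] := timing_exists x lo hi lohi h.
by rewrite (travelE _ _ _ _ _ _ h hT alh blh) hT.2.
Qed.

Lemma travel_refl x a : travel x a a = 0.
Proof. by rewrite /travel subrr. Qed.

Lemma tie_itv3 x a b c : tie (angles x) a b -> tie (angles x) b c ->
  exists lo hi, [/\ lo <= hi, forall s, lo <= s <= hi -> angles x s,
    lo <= a <= hi, lo <= b <= hi & lo <= c <= hi].
Proof.
move=> ab bc; have ac := tie_trans _ _ _ _ ab bc.
exists (Num.min a (Num.min b c)), (Num.max a (Num.max b c)).
rewrite !ge_min !le_max !lexx ?orbT; split=> // s.
rewrite !ge_min !le_max => /andP[h1 h2].
have sub p q : tie (angles x) p q -> (p <= s <= q) || (q <= s <= p) -> angles x s.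
  by move=> pq /orP[]/andP[? ?]; apply: pq; rewrite ge_min le_max; apply/andP;
    split; apply/orP; auto.
have ca := tieC _ _ _ ac; have ba := tieC _ _ _ ab; have cb := tieC _ _ _ bc.
have aa := tie_refl _ _ (tie_l _ _ _ ab); have bb := tie_refl _ _ (tie_l _ _ _ bc).
have cc := tie_refl _ _ (tie_r _ _ _ bc).
by case/or3P: h1 => h1; case/or3P: h2 => h2;
  [apply: (sub _ _ aa)|apply: (sub _ _ ab)|apply: (sub _ _ ac)
  |apply: (sub _ _ ba)|apply: (sub _ _ bb)|apply: (sub _ _ bc)
  |apply: (sub _ _ ca)|apply: (sub _ _ cb)|apply: (sub _ _ cc)]; rewrite h1 h2.
Qed.

Lemma travel_add x a b c : tie (angles x) a b -> tie (angles x) b c ->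
  travel x a c = travel x a b + travel x b c.
Proof.
move=> ab bc; have [lo [hi [lohi h alh blh clh]]] := tie_itv3 _ _ _ _ ab bc.
have [T hT] := timing_exists x lo hi lohi h.
by rewrite !(travelE _ _ _ _ _ _ h hT) //; lra.
Qed.

Lemma travelC x a b : tie (angles x) a b -> travel x b a = - travel x a b.
Proof.
move=> ab; apply/eqP; rewrite -addr_eq0 addrC.
by rewrite -travel_add ?travel_refl //; exact: tieC.
Qed.

Lemma travel_shift x a b (m : int) : tie (angles x) a b ->
  travel x (a + m%:~R * (2 * pi)) (b + m%:~R * (2 * pi)) = travel x a b.
Proof.
move=> /tie_itv[lo [hi [lohi h alh blh]]].
have [T hT] := timing_exists x lo hi lohi h.
rewrite (travelE _ _ _ _ _ _ h hT alh blh).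
set d := m%:~R * (2 * pi).
have hT' : timing x (lo + d) (hi + d) (fun t => T (t - d)).
  split=> [t|s t /andP[? ?] /andP[? ?]].
    apply: (@continuous_comp _ _ _ (fun t => t - d) T); last exact: hT.1.
    exact: (@continuousB R R^o _ id (cst d) t (@cvg_id _ _) (@cvg_cst _ _ _ _ _)).
  rewrite -[in LHS](subrK d s) -[in RHS](subrK d t) !pt_shift addrK.
  by apply: hT.2; apply/andP; split; lra.
have h' s : lo + d <= s <= hi + d -> angles x s.
  move=> /andP[? ?]; rewrite -(subrK d s); apply/angles_shift/h.
  by apply/andP; split; lra.
by rewrite (travelE _ _ _ _ _ _ h' hT') ?addrK // !lerD2r.
Qed.

(** Continuity is itself chained: [S] composes through an intermediate angle because travel times
    add up, and it holds locally because one flow box coordinate computes the times on all nearby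
    fibres. *)
Lemma travel_cont x0 a0 b0 e : tie (angles x0) a0 b0 -> 0 < e ->
  exists N r, [/\ nbhs x0 N, 0 < r & forall x a b, N x ->
    `|a - a0| < r -> `|b - b0| < r ->
    tie (angles x) a b /\ `|travel x a b - travel x0 a0 b0| < e].
Proof.
pose S a0 b0 := forall e, 0 < e ->
  exists N r, [/\ nbhs x0 N, 0 < r & forall x a b, N x ->
    `|a - a0| < r -> `|b - b0| < r ->
    tie (angles x) a b /\ `|travel x a b - travel x0 a0 b0| < e].
have Stie a b : S a b -> tie (angles x0) a b.
  move=> /(_ 1 ltr01)[N [r [/nbhs_singleton Nx r0 h]]].
  by have [] := h x0 a b Nx; rewrite ?subrr ?normr0.
suff S0 : tie (angles x0) a0 b0 -> S a0 b0 by move=> /S0; exact.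
wlog ab : a0 b0 / a0 <= b0 => [h|].
  have [ab|/ltW ba] := leP a0 b0; first exact: h.
  move=> t; have := h b0 a0 ba (tieC _ _ _ t) => {}h {}e /h[N [r [Nx r0 {}h]]].
  exists N, r; split=> // x a b Nx' ar br; have [t' h'] := h x b a Nx' br ar.
  by rewrite !(travelC _ b) ?(travelC _ b0) //; [split; [exact: tieC|] |exact: tieC..];
    rewrite -opprD normrN.
move=> t; apply: (segment_chain S a0 b0 ab).
- move=> u v w Suv Svw {}e e0; have e2 : 0 < e / 2 by rewrite divr_gt0.
  have [N1 [r1 [N1x r10 h1]]] := Suv _ e2.
  have [N2 [r2 [N2x r20 h2]]] := Svw _ e2.
  exists (N1 `&` N2), (Num.min r1 r2); split; first exact: filterI.
    by rewrite lt_min r10.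
  move=> x a b [N1x' N2x']; rewrite !lt_min => /andP[ar1 ar2] /andP[br1 br2].
  have [t1 d1] := h1 x a v N1x' ar1 ltac:(by rewrite subrr normr0).
  have [t2 d2] := h2 x v b N2x' ltac:(by rewrite subrr normr0) br2.
  split; first exact: tie_trans t1 t2.
  rewrite (travel_add _ _ _ _ t1 t2) (travel_add _ _ _ _ (Stie _ _ Suv) (Stie _ _ Svw)).
  clear -d1 d2; move: d1 d2; rewrite !ltr_norml => /andP[? ?] /andP[? ?].
  by apply/andP; split; lra.
- move=> c cab; have xc : angles x0 c.
    by apply: t; rewrite (min_idPl ab) (max_idPr ab).
  have [rho [N [r [Nx r0 h]]]] := local_timing _ _ xc.
  exists r => // u v _ uv _ ur vr {}e e0; have e2 : 0 < e / 2 by rewrite divr_gt0.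
  pose f (q : X * R) := rho (pt q.1 q.2).
  have fE x a b : N x -> `|a - c| < r -> `|b - c| < r ->
      tie (angles x) a b /\ travel x a b = f (x, b) - f (x, a).
    move=> Nx' ar br; have [h1 h2] := h x Nx'.
    pose lo := Num.min a b; pose hi := Num.max a b.
    have lohi : lo <= hi by rewrite ge_min le_max lexx.
    have lor : `|lo - c| < r by rewrite /lo; case: (leP a b).
    have hir : `|hi - c| < r by rewrite /hi; case: (leP a b).
    have tab : tie (angles x) a b by apply: tie_ball ar br => s /h1[].
    split=> //; have alh : lo <= a <= hi by rewrite ge_min le_max lexx.
    have blh : lo <= b <= hi by rewrite ge_min le_max lexx !orbT.
    by rewrite (travelE _ _ _ _ _ _ tab (h2 lo hi lohi lor hir) alh blh) !clampE.
  have Nx0 := nbhs_singleton Nx; have [h1 _] := h x0 Nx0.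
  have [N1 [r1 [N1x r10 k1]]] := nbhs_pair_ball _ _ _
    (continuous_dist f (x0, u) _ (h1 u ur).2 e2).
  have [N2 [r2 [N2x r20 k2]]] := nbhs_pair_ball _ _ _
    (continuous_dist f (x0, v) _ (h1 v vr).2 e2).
  have [d [d0 ud vd]] : exists d, [/\ 0 < d, forall a, `|a - u| < d -> `|a - c| < r
      & forall a, `|a - v| < d -> `|a - c| < r].
    exists (Num.min (r - `|u - c|) (r - `|v - c|)); split.
    - by rewrite lt_min !subr_gt0 ur.
    - move=> a; rewrite lt_min => /andP[au _].
      have := ler_normD (a - u) (u - c); rewrite addrA subrK; lra.
    - move=> a; rewrite lt_min => /andP[_ av].
      have := ler_normD (a - v) (v - c); rewrite addrA subrK; lra.
  exists (N `&` (N1 `&` N2)), (Num.min d (Num.min r1 r2)); split.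
  - by apply: filterI => //; exact: filterI.
  - by rewrite !lt_min d0 r10.
  move=> x a b [Nx' [N1x' N2x']]; rewrite !lt_min.
  move=> /and3P[/ud ar ar1 _] /and3P[/vd br _ br2].
  have [tab ->] := fE x a b Nx' ar br; have [_ ->] := fE x0 u v Nx0 ur vr.
  split=> //; move: (k1 x a N1x' ar1) (k2 x b N2x' br2) => /=; clear.
  rewrite !ltr_norml => /andP[? ?] /andP[? ?].
  by apply/andP; split; lra.
Qed.

(** * Full fibres, arcs and connected sets *)

Definition full x := forall s, angles x s.

Lemma fullP x : full_fibres Y x <-> full x.
Proof.
split=> [fx s|fx [y z] [/= -> _]]; first by apply: fx.
by have [s <-] := expi_surj z; exact: fx.
Qed.

Lemma full_tie x a b : full x -> tie (angles x) a b.
Proof. by move=> fx s _; exact: fx. Qed.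

(** A segment of angles of length [2 pi] would cover the whole circle. *)
Lemma nonfull_tie x a b : ~ full x -> tie (angles x) a b -> `|a - b| < 2 * pi.
Proof.
move=> nfx; wlog ab : a b / a <= b => [h|].
  have [ab|/ltW ba] := leP a b; first exact: h.
  by move=> /tieC; rewrite distrC; apply: h.
move=> t; rewrite distrC ger0_norm ?subr_ge0 // ltNge; apply/negP => ba.
apply: nfx => s; have [m /andP[m1 m2]] := mod2pi s a.
rewrite -(angles_shift _ _ m); apply: t.
by rewrite (min_idPl ab) (max_idPr ab) m1 /=; lra.
Qed.

(** Pins down windings: an angle known modulo [2 pi] is determined by the arc that contains it. *)
Lemma nonfull_tie_shift x a b (m : int) : ~ full x -> tie (angles x) a b ->
  tie (angles x) a (b + m%:~R * (2 * pi)) -> m = 0.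
Proof.
move=> nfx ab ab'; have := nonfull_tie _ _ _ nfx (tie_trans _ _ _ _ (tieC _ _ _ ab) ab').
rewrite opprD addNKr normrN normrM (gtr0_norm (_ : 0 < 2 * pi)) ?mulr_gt0 ?pi_gt0 //.
rewrite -[X in _ < X]mul1r ltr_pM2r ?mulr_gt0 ?pi_gt0 // -intr_norm ltrz1.
by rewrite -[X in _ -> X]/(m = 0) => h; apply/eqP; rewrite -normr_eq0; lia.
Qed.

(** The image has an angle [w] near [v], but a lift may yield another angle of the same point; each
    use has to settle the unknown multiple of [2 pi]. *)
Lemma near_angle (g : Y -> Y) x0 c v e : continuous g ->
  (forall y, base (g y) = base y) -> angles x0 c -> angles x0 v ->
  g (pt x0 c) = pt x0 v -> 0 < e ->
  exists N r, [/\ nbhs x0 N, 0 < r & forall x s, N x -> `|s - c| < r ->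
    angles x s /\ exists w, [/\ `|w - v| < e, angles x w & g (pt x s) = pt x w]].
Proof.
move=> cg bg ac av gv e0.
have hv : nbhs (x0, v) [set q : X * R | `|q.2 - v| < e].
  apply: (@cvg_snd _ _ (nbhs x0) (nbhs v) _ [set s | `|s - v| < e]).
  exact: (dist_ball_nbhs _ e).
have := near_pt _ _ _ av hv; rewrite -gv => /cg /(pt_cont _ _ ac) h.
have [N [r [Nx r0 k]]] := nbhs_pair_ball _ _ _ (filterI (angles_open _ _ ac) h).
exists N, r; split=> // x s Nx' sr; have [/= as_ [w]] := k x s Nx' sr.
by rewrite bg base_pt // => -[aw gw we]; split=> //; exists w.
Qed.

Lemma angle_ball x0 v : angles x0 v ->
  exists2 r, 0 < r & forall s, `|s - v| < r -> angles x0 s.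
Proof. by move=> /angles_open/nbhs_pairl/nbhs_dist_ball. Qed.

(** The points of [C] with an angle tied to [a] form a relatively open and closed subset, because
    close angles are tied to each other. *)
Lemma connected_tie (C : set Y) x a : connected C ->
  (forall y, C y -> base y = x) -> angles x a -> C (pt x a) ->
  forall y, C y -> exists2 b, tie (angles x) a b & y = pt x b.
Proof.
move=> connC baseC xa Ca.
pose P y := exists2 b, tie (angles x) a b & y = pt x b.
pose B := C `&` P.
suff -> : C = B by move=> y [].
have local y : C y -> exists2 W, nbhs y W & forall z, C z -> W z -> (P y <-> P z).
  move=> Cy; have [s xs ys] := ptP y; rewrite (baseC y Cy) in xs ys.
  have [r r0 hr] := angle_ball _ _ xs.
  have hs : nbhs (x, s) [set q : X * R | `|q.2 - s| < r].
    apply: (@cvg_snd _ _ (nbhs x) (nbhs s) _ [set u | `|u - s| < r]).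
    exact: (dist_ball_nbhs _ r).
  have := near_pt _ _ _ xs hs; rewrite -ys => hW.
  eexists; first exact: hW.
  move=> z Cz /= [t]; rewrite (baseC z Cz) => -[xt zt tr].
  have tst : tie (angles x) s t.
    by apply: (tie_ball _ s r) => //; rewrite subrr normr0.
  have step u v : angles x u -> tie (angles x) u v -> P (pt x u) -> P (pt x v).
    move=> xu uv [b ab]; move=> /pt_inj[//||m um]; first exact: tie_r ab.
    exists (v + (- m)%:~R * (2 * pi)); last by rewrite pt_shift.
    have := tie_shift _ _ _ (- m) uv; rewrite {1}um mulrNz mulNr addrK.
    exact: tie_trans.
  by rewrite ys zt; split; [exact: step|apply: step => //; exact: tieC].
have Ba : B !=set0 by exists (pt x a); split=> //; exists a => //; exact: tie_refl.
(* [connected] asks for [B] as the trace of an open set and of a closed set: [O1] is the first, the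
   complement of [O2] the second. *)
pose O1 := [set y : Y | nbhs y [set z | C z -> P z]].
pose O2 := [set y : Y | nbhs y [set z | C z -> ~ P z]].
have oO (Q : set Y) : open [set y : Y | nbhs y Q].
  by rewrite openE => y; exact: nbhs_interior.
symmetry; apply: connC => //.
- exists O1; first exact: oO.
  apply/seteqP; split=> y [Cy].
    move=> Py; split=> //; have [W Wy hW] := local y Cy.
    by apply: (@filterS _ (nbhs y) _ _ _ _ Wy) => z Wz Cz; apply/(hW z Cz Wz).
  by move=> /nbhs_singleton /(_ Cy).
- exists (~` O2); first exact/open_closedC/oO.
  apply/seteqP; split=> y [Cy].
    by move=> Py; split=> // /nbhs_singleton /(_ Cy).
  move=> nO; split=> //; apply: contrapT => nP; apply: nO.
  have [W Wy hW] := local y Cy.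
  by apply: (@filterS _ (nbhs y) _ _ _ _ Wy) => z Wz Cz /(hW z Cz Wz).
Qed.

Lemma tie_enlarge x a b : tie (angles x) a b ->
  exists2 d, 0 < d & tie (angles x) (Num.min a b - d) (Num.max a b + d).
Proof.
move=> ab; have [r1 r10 h1] := angle_ball _ _ (ab (Num.min a b) ltac:(rewrite lexx ge_min le_max lexx//)).
have [r2 r20 h2] := angle_ball _ _ (ab (Num.max a b) ltac:(rewrite lexx ge_min le_max lexx// orbT)).
have [d [d0 d1 d2]] : exists d, [/\ 0 < d, d < r1 & d < r2].
  exists (Num.min r1 r2 / 2); split.
  - by rewrite divr_gt0 // lt_min r10.
  - by rewrite ltr_pdivrMr // gt_min; apply/orP; left; lra.
  - by rewrite ltr_pdivrMr // gt_min; apply/orP; right; lra.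
exists d => //; apply: (tie_trans _ (Num.min a b)).
  apply: (tie_ball _ _ r1 h1); last by rewrite subrr normr0.
  by rewrite addrC addKr normrN gtr0_norm.
apply: (tie_trans _ (Num.max a b)).
  by apply: tie_sub ab _ _; rewrite lexx ge_min le_max lexx // orbT.
apply: (tie_ball _ _ r2 h2); first by rewrite subrr normr0.
by rewrite addrC addKr gtr0_norm.
Qed.

Lemma connected_flow_orbit y : connected (flow_orbit F y).
Proof.
apply: connected_continuous_connected; first by apply/connected_intervalP.
exact/continuous_subspaceT/flow_cont_t.
Qed.

Lemma multiple_const (f : R -> R) : continuous f ->
  (forall s, exists m : int, f s = m%:~R * (2 * pi)) -> forall s t, f s = f t.
Proof.
move=> cf fm; have p0 := @pi_gt0 R; have p2 := @pi_ge2 R.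
suff h s t : s <= t -> f s = f t.
  by move=> s t; have [/h|/ltW/h] := leP s t.
move=> st; have [||m hm] := near_multiple_const f s t 1 _ cf st.
- by apply: le_trans p2; lra.
- by move=> u _; have [m ->] := fm u; exists m; rewrite subrr normr0.
have eqm u : s <= u <= t -> f u = m%:~R * (2 * pi).
  move=> /hm; have [k ->] := fm u; rewrite -mulrBl -intrB normrM.
  rewrite (gtr0_norm (_ : 0 < 2 * pi)) ?mulr_gt0 // -intr_norm => h.
  have [->//|km] := eqVneq k m.
  have : 1 <= `|k - m|%:~R :> R by rewrite ler1z; lia.
  by move=> h'; nra.
by rewrite !eqm ?lexx ?st.
Qed.

(** * Lifts of h and of its square *)

Context (h k : Y -> Y).
Hypotheses (cont_h : continuous h) (cont_k : continuous k)
  (hK : cancel h k) (kK : cancel k h) (base_h : forall y, base (h y) = base y).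

Definition is_lift x (G : R -> R) := [/\ continuous G,
  forall s, h (pt x s) = pt x (G s) & forall s, G (s + 2 * pi) = G s - 2 * pi].

Section Lifts.
Context (x : X) (fx : full x).

Lemma lift_shift G s (m : int) : is_lift x G ->
  G (s + m%:~R * (2 * pi)) = G s - m%:~R * (2 * pi).
Proof.
move=> [_ _ Gs].
have nat_shift (n : nat) t : G (t + n%:R * (2 * pi)) = G t - n%:R * (2 * pi).
  elim: n t => [|n IH] t; first by rewrite !mul0r addr0 subr0.
  by rewrite -natr1 mulrDl mul1r addrA Gs IH opprD addrA.
case: m => n; first exact: nat_shift.
rewrite NegzE mulrNz mulNr opprK.
by rewrite -[in RHS](subrK (n.+1%:R * (2 * pi)) s) nat_shift subrK.
Qed.

(** Equal values come from angles differing by [2 pi m], as [h] is injective; degree -1 shifts the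
    value by [- 2 pi m], so [m = 0]. *)
Lemma lift_inj G : is_lift x G -> injective G.
Proof.
move=> lG s t st; have [cG hG _] := lG.
have /(can_inj hK)/(pt_inj _ _ _ (fx s) (fx t))[m sm] : h (pt x s) = h (pt x t).
  by rewrite !hG st.
move: st; rewrite sm lift_shift // => /eqP.
rewrite -subr_eq0 addrC addKr oppr_eq0 mulf_eq0 => /orP[/eqP ->|].
  by rewrite mul0r addr0.
by have p0 := @pi_gt0 R; rewrite mulf_eq0 => /orP[]/eqP; lra.
Qed.

(** A continuous injection of the line is strictly monotone, and [G (2 pi) = G 0 - 2 pi] excludes
    the increasing case. *)
Lemma lift_dec G : is_lift x G -> {mono G : s t /~ s < t}.
Proof.
move=> lG; have [cG hG Gs] := lG; have p0 := @pi_gt0 R.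
have [inc|dec] := @itv_continuous_inj_mono R G `]-oo, +oo[
  (continuous_subspaceT cG) (fun s t _ _ => lift_inj _ lG s t).
- have := inc 0 (0 + 2 * pi); rewrite !in_itv /= Gs => /(_ isT isT) e.
  have : G 0 < G 0 - 2 * pi by apply: e; lra.
  by lra.
- have hd s t : s < t -> G t < G s by apply: dec; rewrite in_itv.
  move=> s t; have [ts|st|->] := ltgtP t s; last by rewrite ltxx.
  + exact: hd.
  + by apply/negbTE; rewrite -leNgt ltW // hd.
Qed.

Lemma lift_ge G : is_lift x G -> {mono G : s t /~ s <= t}.
Proof. by move=> lG s t; rewrite !leNgt lift_dec. Qed.

Lemma lift_fix G : is_lift x G -> exists c, G c = c.
Proof.
move=> lG; have [cG hG Gs] := lG; have p0 := @pi_gt0 R; have p2 := @pi_ge2 R.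
(* Since [|G 0| < n], the function [G s - s] is positive at [- 2 pi n] and negative at [2 pi n]. *)
pose n := Num.bound `|G 0|; have hn : `|G 0| < n%:R by exact/archi_boundP/normr_ge0.
pose f s := G s - s.
have cf : continuous f.
  by move=> s; exact: (@continuousB R R^o _ G id s (cG s) (@cvg_id _ _)).
have e1 : G (n%:R * (2 * pi)) = G 0 - n%:R * (2 * pi).
  by have := lift_shift G 0 n lG; rewrite add0r.
have e2 : G (- (n%:R * (2 * pi))) = G 0 + n%:R * (2 * pi).
  by have := lift_shift G 0 (- n%:Z) lG; rewrite add0r mulrNz mulNr opprK.
have n0 : 0 <= n%:R :> R by [].
have [||c _ fc] := continuous_ivt f (- (n%:R * (2 * pi))) (n%:R * (2 * pi)) 0 cf.
- by nra.
- rewrite /f e1 e2 ge_min le_max; move: hn; rewrite ltr_norml => /andP[? ?].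
  by apply/andP; split; apply/orP; [right|left]; nra.
- by exists c; move/eqP: fc; rewrite subr_eq0 => /eqP.
Qed.

Lemma lift_sq_fix G u : is_lift x G ->
  exists c, [/\ u <= c < u + 2 * pi & G (G c) = c].
Proof.
move=> lG; have [c Gc] := lift_fix G lG; have [m hm] := mod2pi c u.
exists (c + m%:~R * (2 * pi)); split=> //.
rewrite lift_shift // Gc -mulNr -mulrNz lift_shift // Gc.
by rewrite mulrNz mulNr opprK.
Qed.

Lemma lift_sq_shift G u (m : int) : is_lift x G ->
  G (G (u + m%:~R * (2 * pi))) = G (G u) + m%:~R * (2 * pi).
Proof.
move=> lG; rewrite lift_shift // -mulNr -mulrNz lift_shift //.
by rewrite mulrNz mulNr opprK.
Qed.

(** An increasing map does not cross its fixed points, and those of [G \o G] recur with period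
    [2 pi]: the iterates of [u] stay between [c - 2 pi] and [c]. *)
Lemma lift_sq_iter G u n : is_lift x G ->
  u - 2 * pi <= iter n (G \o G) u < u + 2 * pi.
Proof.
move=> lG; have [c [/andP[uc cu] Gc]] := lift_sq_fix G u lG.
have Gc' : G (G (c - 2 * pi)) = c - 2 * pi.
  by have := lift_sq_shift G c (-1) lG; rewrite Gc mulN1r.
have mono s t : s <= t -> G (G s) <= G (G t) by move=> st; rewrite !lift_ge.
suff /andP[h1 h2] : c - 2 * pi <= iter n (G \o G) u <= c by apply/andP; split; lra.
elim: n => [|n /andP[h1 h2]]; first by apply/andP; split=> /=; lra.
by have := mono _ _ h1; have := mono _ _ h2; rewrite Gc Gc' iterS /= => -> ->.
Qed.

(** Strictness matters: in [arrival_eq0] it separates a zero displacement from a full turn. *)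
Lemma lift_sq_near G u : is_lift x G -> `|G (G u) - u| < 2 * pi.
Proof.
move=> lG; have [c [/andP[uc cu] Gc]] := lift_sq_fix G u lG.
have Gc' : G (G (c - 2 * pi)) = c - 2 * pi.
  by have := lift_sq_shift G c (-1) lG; rewrite Gc mulN1r.
have h1 : G (G u) <= c by rewrite -Gc !lift_ge.
have h2 : c - 2 * pi < G (G u) by rewrite -Gc' !lift_dec //; lra.
by rewrite ltr_norml; apply/andP; split; lra.
Qed.

Lemma lift_diff G G' : is_lift x G -> is_lift x G' ->
  exists m : int, forall s, G' s = G s + m%:~R * (2 * pi).
Proof.
move=> [cG hG _] [cG' hG' _].
have hm s : exists m : int, G' s - G s = m%:~R * (2 * pi).
  have [|m e] := pt_inj x (G' s) (G s) (fx _) (fx _); first by rewrite -hG hG'.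
  by exists m; rewrite e addrC addKr.
have c := multiple_const (fun s => G' s - G s)
  (fun s => @continuousB R R^o _ G' G s (cG' s) (cG s)) hm.
by have [m em] := hm 0; exists m => s; rewrite -em -(c s 0) addrC subrK.
Qed.

Lemma lift_sq_unique G G' u : is_lift x G -> is_lift x G' ->
  G' (G' u) = G (G u).
Proof.
move=> lG lG'; have [m hm] := lift_diff G G' lG lG'.
by rewrite [G' u]hm lift_shift // hm addrK.
Qed.

Lemma lift_translate G (m : int) : is_lift x G ->
  is_lift x (fun s => G s + m%:~R * (2 * pi)).
Proof.
move=> [cG hG Gs]; split.
- by move=> s; exact: (@continuousD R R^o _ G (cst _) s (cG s) (@cvg_cst _ _ _ _ _)).
- by move=> s; rewrite hG pt_shift.
- by move=> s; rewrite Gs addrAC.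
Qed.

Lemma lift_iter G u n : is_lift x G ->
  iter n (h \o h) (pt x u) = pt x (iter n (G \o G) u).
Proof. by move=> [_ hG _]; elim: n => //= n ->; rewrite !hG. Qed.

End Lifts.

(** * Lifts over fibres close to a given one *)

Lemma near_full x0 : full x0 -> nbhs x0 full.
Proof.
move=> fx0; have p0 := @pi_gt0 R.
have near_h := near_segment x0 0 (2 * pi) (fun x s => angles x s)
  (fun c _ => nbhs_pair_ball _ _ _ (angles_open _ _ (fx0 c))).
apply: (@filterS _ (nbhs x0) _ _ _ _ near_h) => x hx s.
have [m /andP[m1 m2]] := mod2pi s 0.
by rewrite -(angles_shift _ _ m); apply: hx; rewrite m1 /=; lra.
Qed.

(** No lift over [x0] is needed: [h] maps the compact segment over [x0] into [Y], so for [x] near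
    [x0] the angles [G s] stay in the open set [angles x0], and continuity of [G] makes their
    segment an arc. *)
Lemma near_tie_lift x0 a b : tie (angles x0) a b ->
  exists N d, [/\ nbhs x0 N, 0 < d & forall x G s t, N x -> full x ->
    is_lift x G -> `|s - a| < d -> `|t - b| < d ->
    tie (angles x0) s t /\ tie (angles x0) (G s) (G t)].
Proof.
(* The margin [d] makes room for [s] and [t] slightly outside the segment between [a] and [b]. *)
move=> /tie_enlarge[d d0]; set lo := _ - d; set hi := _ + d => lohi.
have lh : lo <= hi.
  have : Num.min a b <= Num.max a b by rewrite ge_min le_max lexx.
  by rewrite /lo /hi; lra.
have near_h := near_segment x0 lo hi
  (fun x s => full x -> forall G, is_lift x G -> angles x0 (G s)).
exists [set x | forall s, lo <= s <= hi ->
   full x -> forall G, is_lift x G -> angles x0 (G s)], d; split=> //.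
  apply: near_h => c clh.
  have ac : angles x0 c by apply: lohi; rewrite (min_idPl lh) (max_idPr lh).
  have [v av hv] := ptP (h (pt x0 c)); rewrite base_h base_pt // in av hv.
  have [e e0 he] := angle_ball _ _ av.
  have [N [r [Nx r0 hN]]] := near_angle h x0 c v e cont_h base_h ac av hv e0.
  exists N, r; split=> // x s Nx' sr fx G [_ hG _].
  have [_ [w [we aw]]] := hN x s Nx' sr; rewrite hG => /pt_inj[//||m ->].
    exact: fx.
  by apply/angles_shift; exact: he.
move=> x G s t hx fx lG sa tb.
have lohi' u : lo <= u <= hi -> Num.min lo hi <= u <= Num.max lo hi.
  by rewrite (min_idPl lh) (max_idPr lh).
have slh : lo <= s <= hi.
  have h1 : Num.min a b <= a <= Num.max a b by rewrite ge_min le_max lexx.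
  move: sa h1; rewrite ltr_distl /lo /hi => /andP[? ?] /andP[? ?].
  by apply/andP; split; lra.
have tlh : lo <= t <= hi.
  have h1 : Num.min a b <= b <= Num.max a b by rewrite ge_min le_max lexx !orbT.
  move: tb h1; rewrite ltr_distl /lo /hi => /andP[? ?] /andP[? ?].
  by apply/andP; split; lra.
split; first by apply: tie_sub lohi _ _; exact: lohi'.
move: slh tlh; clear sa tb; wlog st : s t / s <= t.
  move=> H slh tlh; have [st|/ltW ts] := leP s t; first exact: H.
  by apply: tieC; exact: H.
move=> slh tlh u hu; have [cG _ _] := lG.
have [c cst <-] := continuous_ivt G s t u cG st hu.
by apply: hx => //; exact: itv_convex cst.
Qed.

Hypotheses
  (fin_orbits : forall x, finite_set
    [set set_val @` flow_orbit F y | y in [set y | base y = x]])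
  (dense_full : forall x W, nbhs x W -> exists2 x', W x' & full x')
  (has_lift : forall x, full x -> exists G, is_lift x G).

Lemma base_iter n (f : Y -> Y) y : (forall y, base (f y) = base y) ->
  base (iter n f y) = base y.
Proof. by move=> bf; elim: n => //= n; rewrite bf. Qed.

Lemma base_k y : base (k y) = base y.
Proof. by rewrite -{2}(kK y) base_h. Qed.

Lemma continuous_iter n (f : Y -> Y) : continuous f -> continuous (iter n f).
Proof.
move=> cf; elim: n => [|n IH] y; first by move=> P.
by apply: (@continuous_comp _ _ _ (iter n f) f); [exact: IH|exact: cf].
Qed.

(* Pigeonhole on the finitely many leaves over [x]. *)
Lemma recurrence y : exists n (C : set Y), [/\ (0 < n)%N, connected C,
  forall z, C z -> base z = base y, C y & C (iter n (h \o h) y)].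
Proof.
pose z i := iter i (h \o h) y.
have bz i : base (z i) = base y by rewrite base_iter // => w; rewrite /= !base_h.
have [A [I infI hI]] : exists A, exists2 I, infinite_set I &
    forall i, I i <-> set_val @` flow_orbit F (z i) = A.
  apply: (@finite_range_cst_subsequence _ (fun i => set_val @` flow_orbit F (z i))).
  apply: sub_finite_set (fin_orbits (base y)) => _ [i _ <-].
  by exists (z i) => //=; exact: bz.
have [i Ii] : exists i, I i.
  apply: contrapT => nI; apply: infI; rewrite (_ : I = set0) // -subset0 => i Ii.
  by apply: nI; exists i.
have [j Ij ij] : exists2 j, I j & (i < j)%N.
  apply: contrapT => nI; apply: infI; apply: (sub_finite_set _ (finite_II i.+1)).
  move=> j Ij /=; rewrite ltnS leqNgt; apply/negP => ij.
  by apply: nI; exists j.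
have [t _ zt] : flow_orbit F (z i) (z j).
  have : (set_val @` flow_orbit F (z j)) (set_val (z j)).
    by exists (z j) => //; exists 0; rewrite ?flow0.
  by rewrite ((hI j).1 Ij) -((hI i).1 Ii) => -[w wo /val_inj <-].
(* The pigeonhole puts [z i] and [z j] on one orbit; pulling that orbit back by [f] gives a
   connected set through [y] and its iterate of order [j - i]. *)
pose f := iter i (k \o k).
have cf : continuous f.
  apply: continuous_iter => w.
  by apply: (@continuous_comp _ _ _ k k); exact: cont_k.
have bf w : base (f w) = base w.
  by rewrite /f base_iter // => v; rewrite /= !base_k.
have fz n : f (z (n + i)%N) = z n.
  rewrite /f /z addnC iterD; elim: (i) (iter n _ y) => // p IH w.
  by rewrite iterSr iterS /= !hK.
exists (j - i)%N, (f @` flow_orbit F (z i)); split.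
- by rewrite subn_gt0.
- apply: connected_continuous_connected; first exact: connected_flow_orbit.
  exact: continuous_subspaceT.
- by move=> _ [_ [u _ <-] <-]; rewrite bf base_flow bz.
- by exists (z i); [exists 0; rewrite ?flow0|exact: (fz 0%N)].
- exists (z j); first by exists t.
  by have := fz (j - i)%N; rewrite subnK // ltnW.
Qed.

Lemma lift_mod x w w' (v e : R) : full x -> pt x w = pt x w' ->
  `|w' - v| < e -> exists m : int, `|w + m%:~R * (2 * pi) - v| < e.
Proof.
move=> fx /(pt_inj _ _ _ (fx _) (fx _))[i ->] h'.
by exists (- i); rewrite mulrNz mulNr addrK.
Qed.

(** Recurrence of the arcs over [x0] constrains all lifts nearby. Uniformity in [x], [u] and [G] is
    what makes this serve both the existence of a distinguished lift over [x0] and its continuity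
    there. *)
Lemma lift_return x0 u0 : ~ full x0 -> angles x0 u0 ->
  exists N d, [/\ nbhs x0 N, 0 < d & forall x u G, N x -> `|u - u0| < d ->
    full x -> is_lift x G -> tie (angles x0) u0 (G (G u))].
Proof.
move=> nfx a0; pose hh := h \o h.
have bhh y : base (hh y) = base y by rewrite /hh /= !base_h.
have chh : continuous hh.
  by move=> y; apply: (@continuous_comp _ _ _ h h); exact: cont_h.
have [n [C [n0 connC baseC C0 Cn]]] := recurrence (pt x0 u0).
rewrite base_pt // in baseC.
have [a ta za] := connected_tie C x0 u0 connC baseC a0 C0 _ Cn.
have [v av hv] := ptP (h (pt x0 u0)); rewrite base_h base_pt // in av hv.
pose hC := h @` C.
have [b tb zb] : exists2 b, tie (angles x0) v b & h (iter n hh (pt x0 u0)) = pt x0 b.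
  apply: (connected_tie hC) => //.
  - apply: connected_continuous_connected => //; exact: continuous_subspaceT.
  - by move=> _ [y Cy <-]; rewrite base_h baseC.
  - by rewrite -hv; exists (pt x0 u0).
  - by exists (iter n hh (pt x0 u0)).
have [N1 [d1 [N1x d10 near1]]] := near_tie_lift _ _ _ ta.
have [N2 [d2 [N2x d20 near2]]] := near_tie_lift _ _ _ tb.
have [N3 [d3 [N3x d30 near3]]] := near_angle h x0 u0 v d2 cont_h base_h a0 av hv d20.
have [N4 [d4 [N4x d40 near4]]] := near_angle (iter n hh) x0 u0 a d1
  (continuous_iter n _ chh) (fun y => base_iter n _ y bhh) a0 (tie_r _ _ _ ta) za d10.
have cn : continuous (fun y => h (iter n hh y)).
  move=> y; apply: (@continuous_comp _ _ _ (iter n hh) h); last exact: cont_h.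
  exact: continuous_iter.
have bn y : base (h (iter n hh y)) = base y by rewrite base_h base_iter.
have [N5 [d5 [N5x d50 near5]]] := near_angle _ x0 u0 b d2 cn bn a0 (tie_r _ _ _ tb) zb d20.
have [e e0 he] := angle_ball _ _ a0.
exists (N1 `&` (N2 `&` (N3 `&` (N4 `&` N5)))),
  (Num.min e (Num.min d1 (Num.min d3 (Num.min d4 d5)))).
split.
- exact: (filterI N1x (filterI N2x (filterI N3x (filterI N4x N5x)))).
- by rewrite !lt_min e0 d10 d30 d40.
move=> x u G [Nx1 [Nx2 [Nx3 [Nx4 Nx5]]]]; rewrite !lt_min.
move=> /and5P[ue ud1 ud3 ud4 ud5] fx lG; have [cG hG Gs] := lG.
have [_ [w3 [w3v _ e3]]] := near3 x u Nx3 ud3.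
have [_ [w4 [w4a _ e4]]] := near4 x u Nx4 ud4.
have [_ [w5 [w5b _ e5]]] := near5 x u Nx5 ud5.
rewrite hG in e3; rewrite (lift_iter x G u n lG) in e4.
rewrite (lift_iter x G u n lG) hG in e5.
set H := G \o G in e4 e5.
have [i hi] := lift_mod _ _ _ _ _ fx e3 w3v.
have [m hm] := lift_mod _ _ _ _ _ fx e4 w4a.
have [j hj] := lift_mod _ _ _ _ _ fx e5 w5b.
have [t1 t2] := near1 x G u _ Nx1 fx lG ud1 hm.
have [t3 t4] := near2 x G _ _ Nx2 fx lG hi hj.
rewrite (lift_shift x _ _ _ lG) in t2.
rewrite !(lift_shift x _ _ _ lG) in t4.
(* [t2] and the translate of [t3] tie [G u] to two translates of the same angle; an arc contains
   only one of them. *)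
have mij : m = i - j.
  have := tie_shift _ _ _ (- i) t3; rewrite mulrNz mulNr addrK => t3'.
  suff /eqP : j - i + m = 0 by rewrite addrC addr_eq0 opprB => /eqP.
  apply: (nonfull_tie_shift _ _ _ _ nfx t2).
  by apply: (tie_eq _ _ _ _ _ t3') => //; rewrite !intrD mulrNz; lra.
have tu : tie (angles x0) u (G (G u)).
  have homoH : {homo H : s t / s <= t}.
    by move=> s t st; rewrite /H /= !(lift_ge x fx).
  have [up down] := iter_homo H u n homoH n0.
  apply: (tie_order _ (2 * pi) (- m) _ _ (iter n H u) (iter n.+1 H u)) => //.
  - by rewrite mulr_gt0 // pi_gt0.
  - by move=> s t; exact: nonfull_tie.
  - by rewrite mulrNz mulNr opprK.
  (* Translated by [i], [t4] says that [H u] returns to its arc with the same multiple [m] as [u]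
     does in [t1]. *)
  - have := tie_shift _ _ _ i t4; rewrite subrK mulrNz mulNr opprK.
    move=> t4'; apply: (tie_eq _ _ _ _ _ t4') => //.
    by rewrite iterS /H /= mij intrB; lra.
  - by move=> /ltW/up/andP[].
  - by move=> /ltW/down/andP[].
  - have := lift_sq_iter x fx G u n.+1 lG; rewrite -/H => /andP[h1 h2].
    by rewrite h1 ltW.
apply: tie_trans tu.
by apply: (tie_ball _ u0 e he) => //; rewrite subrr normr0.
Qed.

(* [w] is the distinguished lift of [h (h (pt x u))]: over a full fibre the one
   given by a lift of [h], otherwise the one in the same arc as [u]. *)
Definition sq_lift x u w :=
  (full x -> exists2 G, is_lift x G & w = G (G u)) /\
  (~ full x -> tie (angles x) u w /\ h (h (pt x u)) = pt x w).

Lemma sq_lift_tie x u w : sq_lift x u w -> tie (angles x) u w.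
Proof.
by move=> [_ nf]; have [fx|/nf[]//] := pselect (full x); exact: full_tie.
Qed.

Lemma sq_liftE x u w : sq_lift x u w -> h (h (pt x u)) = pt x w.
Proof.
move=> [f nf]; have [/f[G [_ hG _] ->]|/nf[]//] := pselect (full x).
by rewrite !hG.
Qed.

Lemma sq_lift_near x u w : sq_lift x u w -> `|w - u| < 2 * pi.
Proof.
move=> [f nf]; have [fx|nfx] := pselect (full x).
  by have [G lG ->] := f fx; exact: lift_sq_near.
by have [/(nonfull_tie _ _ _ nfx)] := nf nfx; rewrite distrC.
Qed.

Lemma sq_lift_unique x u w w' : sq_lift x u w -> sq_lift x u w' -> w = w'.
Proof.
move=> [f nf] [f' nf']; have [fx|nfx] := pselect (full x).
  have [G lG ->] := f fx; have [G' lG' ->] := f' fx.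
  exact: lift_sq_unique.
have [t e] := nf nfx; have [t' e'] := nf' nfx.
have [||m wm] := pt_inj x w w' _ _ (etrans (esym e) e'); [exact: tie_r t|exact: tie_r t'|].
by move: t; rewrite wm => /(nonfull_tie_shift _ _ _ _ nfx t') ->; rewrite mul0r addr0.
Qed.

Lemma sq_lift_shift x u w (m : int) : sq_lift x u w ->
  sq_lift x (u + m%:~R * (2 * pi)) (w + m%:~R * (2 * pi)).
Proof.
move=> [f nf]; split=> [fx|nfx].
  by have [G lG ->] := f fx; exists G => //; rewrite (lift_sq_shift x).
by have [t e] := nf nfx; rewrite !pt_shift; split=> //; exact: tie_shift.
Qed.

Let hh := h \o h.
Let base_hh y : base (hh y) = base y. Proof. by rewrite /hh /= !base_h. Qed.
Let cont_hh : continuous hh.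
Proof. by move=> y; apply: (@continuous_comp _ _ _ h h); exact: cont_h. Qed.

(** Over a fibre that is not full, a single full fibre nearby suffices: [lift_return] places
    [G (G u)] in the arc of [u], and by continuity an angle of [h (h (pt x u))] lies in that arc
    too. *)
Lemma sq_lift_exists x u : angles x u -> exists w, sq_lift x u w.
Proof.
move=> xu; have [fx|nfx] := pselect (full x).
  by have [G lG] := has_lift x fx; exists (G (G u)); split=> // _; exists G.
have [N [d [Nx d0 near1]]] := lift_return _ _ nfx xu.
have [v av hv] := ptP (hh (pt x u)); rewrite base_hh base_pt // in av hv.
have [e e0 he] := angle_ball _ _ av.
have [N' [d' [N'x d'0 near2]]] := near_angle hh x u v e cont_hh base_hh xu av hv e0.
have [x' [Nx' N'x'] fx'] := dense_full x _ (filterI Nx N'x).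
have [G lG] := has_lift _ fx'; have [_ hG _] := lG.
have uu r : 0 < r -> `|u - u| < r by rewrite subrr normr0.
have t := near1 x' u G Nx' (uu _ d0) fx' lG.
have [_ [w [wv _]]] := near2 x' u N'x' (uu _ d'0).
rewrite /hh /= !hG => /(pt_inj _ _ _ (fx' _) (fx' _))[m wm].
exists (v + m%:~R * (2 * pi)); split=> // _; rewrite pt_shift; split=> //.
apply: tie_trans t _; rewrite wm; apply: tie_shift.
by apply: (tie_ball _ v e he) => //; rewrite subrr normr0.
Qed.

(** Continuity of [h \o h] controls [w] modulo [2 pi]; only a jump by [2 pi m] remains to be
    excluded. *)
Lemma sq_lift_cont_nonfull x0 u0 w0 e : ~ full x0 -> sq_lift x0 u0 w0 -> 0 < e ->
  exists N d, [/\ nbhs x0 N, 0 < d & forall x u w, N x -> `|u - u0| < d ->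
    sq_lift x u w -> `|w - w0| < e].
Proof.
move=> nfx s0 e0; have t0 := sq_lift_tie _ _ _ s0; have e1 := sq_liftE _ _ _ s0.
have a0 := tie_l _ _ _ t0; have aw := tie_r _ _ _ t0.
have [N1 [d1 [N1x d10 near1]]] := lift_return _ _ nfx a0.
(* Only the tie on nearby fibres is wanted, so the bound 1 is arbitrary. *)
have [N2 [d2 [N2x d20 near2]]] := travel_cont _ _ _ 1 t0 ltr01.
have [r r0 hr] := angle_ball _ _ aw.
have e'0 : 0 < Num.min e (Num.min r d2) by rewrite !lt_min e0 r0.
have [N3 [d3 [N3x d30 near3]]] :=
  near_angle hh x0 u0 w0 _ cont_hh base_hh a0 aw e1 e'0.
exists (N1 `&` (N2 `&` N3)), (Num.min d1 (Num.min d2 d3)); split.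
- exact: (filterI N1x (filterI N2x N3x)).
- by rewrite !lt_min d10 d20.
move=> x u w [Nx1 [Nx2 Nx3]]; rewrite !lt_min => /and3P[u1 u2 u3] s.
have [_ [v [vw av hv]]] := near3 x u Nx3 u3.
move: vw; rewrite !lt_min => /and3P[ve vr vd].
have [tuv _] := near2 x u v Nx2 u2 vd.
have pwv : pt x w = pt x v by rewrite -(sq_liftE _ _ _ s) -hv.
have [m wm] := pt_inj _ _ _ (tie_r _ _ _ (sq_lift_tie _ _ _ s)) av pwv.
suff m0 : m = 0 by rewrite wm m0 mul0r addr0.
(* If [x] is full, the arcs over [x0] exclude the jump through [lift_return]; otherwise the arcs
   over [x] itself do, since [u] is tied there to both [v] and [w]. *)
have [fx|nfx'] := pselect (full x).
  have [f _] := s; have [G lG wG] := f fx.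
  have := near1 x u G Nx1 u1 fx lG; rewrite -wG wm.
  apply: nonfull_tie_shift => //; apply: tie_trans t0 _.
  by apply: (tie_ball _ w0 r hr) => //; rewrite subrr normr0.
have := sq_lift_tie _ _ _ s; rewrite wm.
exact: nonfull_tie_shift.
Qed.

(** Every lift over a nearby fibre is uniformly close to [G0] up to one translation: closeness
    modulo [2 pi] is obtained on a period, [near_multiple_const] selects a single multiple, and
    equivariance extends it to the line. The square does not see the translation. *)
Lemma sq_lift_cont_full x0 u0 w0 e : full x0 -> sq_lift x0 u0 w0 -> 0 < e ->
  exists N d, [/\ nbhs x0 N, 0 < d & forall x u w, N x -> `|u - u0| < d ->
    sq_lift x u w -> `|w - w0| < e].
Proof.
move=> fx0 [/(_ fx0)[G0 lG0 ->] _] e0; have [cG0 hG0 G0s] := lG0.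
have e2 : 0 < e / 2 by rewrite divr_gt0.
have [d1 d10 near1] := nbhs_dist_ball _ _ (continuous_dist G0 _ _ (cG0 (G0 u0)) e2).
(* The bound 1 keeps [q] below [pi]; [e / 2] and [d1 / 2] absorb the errors of the outer and of the
   inner application of the lift. *)
pose q := Num.min 1 (Num.min (e / 2) (d1 / 2)).
have q0 : 0 < q by rewrite !lt_min ltr01 e2 divr_gt0.
have [q1 qe qd] : [/\ q <= 1, q <= e / 2 & q <= d1 / 2].
  by rewrite !ge_min !lexx !orbT.
have q2 : 0 < q / 2 by rewrite divr_gt0.
have p0 := @pi_gt0 R; have p2 := @pi_ge2 R.
have near_G := near_segment x0 0 (2 * pi) (fun x s => full x -> forall G, is_lift x G ->
  exists m : int, `|G s - G0 s - m%:~R * (2 * pi)| < q).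
have nG : nbhs x0 [set x | forall s, 0 <= s <= 2 * pi -> full x ->
    forall G, is_lift x G -> exists m : int, `|G s - G0 s - m%:~R * (2 * pi)| < q].
  apply: near_G => c _.
  have [N [r [Nx r0 hN]]] := near_angle h x0 c (G0 c) (q / 2) cont_h base_h
    (fx0 c) (fx0 _) (hG0 c) q2.
  have [r' r'0 hr'] := nbhs_dist_ball _ _ (continuous_dist G0 _ _ (cG0 c) q2).
  exists N, (Num.min r r'); split=> //; first by rewrite lt_min r0.
  move=> x s Nx'; rewrite lt_min => /andP[sr sr'] fx G [_ hG _].
  have [_ [w [wq aw]]] := hN x s Nx' sr; rewrite hG => /(pt_inj _ _ _ (fx _) aw)[m ->].
  exists m; have := hr' s sr' => /=; move: wq; rewrite !ltr_norml.
  by move=> /andP[? ?] /andP[? ?]; apply/andP; split; lra.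
have d12 : 0 < d1 / 2 by rewrite divr_gt0.
have [d2 d20 near2] := nbhs_dist_ball _ _ (continuous_dist G0 _ _ (cG0 u0) d12).
exists ([set x | forall s, 0 <= s <= 2 * pi -> full x ->
    forall G, is_lift x G -> exists m : int, `|G s - G0 s - m%:~R * (2 * pi)| < q]
  `&` full), d2; split=> //; first exact: (filterI nG (near_full _ fx0)).
move=> x u w [/= hx fx] ud [/(_ fx)[G lG ->] _]; have [cG hG Gs] := lG.
have [m hm] : exists m : int, forall s, 0 <= s <= 2 * pi ->
    `|(G s - G0 s) - m%:~R * (2 * pi)| < q.
  apply: (near_multiple_const (fun s => G s - G0 s)) => //.
  - by apply: (le_trans q1); apply: le_trans p2; rewrite ler1n.
  - by move=> s; exact: (@continuousB R R^o _ G G0 s (cG s) (cG0 s)).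
  - by rewrite mulr_ge0 // ltW.
  - by move=> s hs; exact: hx.
pose G1 s := G s + (- m)%:~R * (2 * pi).
have lG1 : is_lift x G1 := lift_translate x G (- m) lG.
have G1G0 s : `|G1 s - G0 s| < q.
  have [i /andP[i1 i2]] := mod2pi s 0.
  have hi : 0 <= s + i%:~R * (2 * pi) <= 2 * pi by rewrite i1 /=; lra.
  have := hm _ hi; rewrite (lift_shift x _ _ _ lG) (lift_shift x0 _ _ _ lG0).
  rewrite /G1 mulrNz mulNr; set I := i%:~R * _; set M := m%:~R * _.
  by rewrite (_ : G s - I - (G0 s - I) - M = G s - M - G0 s) //; ring.
rewrite -(lift_sq_unique x fx G G1 u lG lG1).
have h1 := G1G0 u; have h2 := G1G0 (G1 u); have h3 := near2 u ud.
have h4 : `|G1 u - G0 u0| < d1.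
  move: h1 h3 => /=; rewrite !ltr_norml => /andP[? ?] /andP[? ?].
  by apply/andP; split; lra.
have := near1 _ h4 => /=; move: h2; rewrite !ltr_norml => /andP[? ?] /andP[? ?].
by apply/andP; split; lra.
Qed.

Lemma sq_lift_cont x0 u0 w0 e : sq_lift x0 u0 w0 -> 0 < e ->
  exists N d, [/\ nbhs x0 N, 0 < d & forall x u w, N x -> `|u - u0| < d ->
    sq_lift x u w -> `|w - w0| < e].
Proof.
by have [f|f] := pselect (full x0);
  [exact: sq_lift_cont_full|exact: sq_lift_cont_nonfull].
Qed.

(** * The arrival time of the square *)

Definition arrival y : R := xget 0 [set t | exists u w,
  [/\ y = pt (base y) u, sq_lift (base y) u w & t = travel (base y) u w]].

(** The choice of angle in [arrival] is immaterial: a translation of [u] moves the distinguished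
    lift along and preserves the travel time. *)
Lemma arrivalE x u w : sq_lift x u w -> arrival (pt x u) = travel x u w.
Proof.
move=> s; have t := sq_lift_tie _ _ _ s; have xu := tie_l _ _ _ t.
rewrite /arrival base_pt //; case: xgetP => [_ -> [u' [w' [e s' ->]]]|].
  have t' := sq_lift_tie _ _ _ s'.
  have [m um] := pt_inj _ _ _ xu (tie_l _ _ _ t') e.
  have := sq_lift_shift _ _ _ m s'; rewrite -um => /(sq_lift_unique _ _ _ _ s) ->.
  by rewrite um travel_shift.
by move=> /(_ (travel x u w)) []; exists u, w.
Qed.

Lemma arrival_spec y : exists u w, [/\ y = pt (base y) u,
  sq_lift (base y) u w & arrival y = travel (base y) u w].
Proof.
have [u au yu] := ptP y; have [w s] := sq_lift_exists _ _ au.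
by exists u, w; split=> //; rewrite {1}yu; exact: arrivalE.
Qed.

Lemma arrivalP y : hh y = F (y, arrival y).
Proof.
have [u [w [yu s ->]]] := arrival_spec y.
by rewrite {2}yu (travelP _ _ _ (sq_lift_tie _ _ _ s)) -(sq_liftE _ _ _ s) -yu.
Qed.

(** If [h (h y) = y], the lift moves [u] by a multiple of [2 pi], and [sq_lift_near] leaves only the
    multiple 0. *)
Lemma arrival_eq0 y : arrival y = 0 <-> hh y = y.
Proof.
split=> [y0|]; first by rewrite arrivalP y0 flow0.
have [u [w [yu s ->]]] := arrival_spec y; have t := sq_lift_tie _ _ _ s.
rewrite {1 2}yu /hh /= (sq_liftE _ _ _ s).
move=> /(pt_inj _ _ _ (tie_r _ _ _ t) (tie_l _ _ _ t))[m wm].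
have := sq_lift_near _ _ _ s; rewrite wm addrC addKr => m1.
have p2 : 0 < 2 * pi :> R by rewrite mulr_gt0 // pi_gt0.
suff -> : m = 0 by rewrite mul0r addr0 travel_refl.
exact: int_mul_small p2 m1.
Qed.

Lemma arrival_cont : continuous arrival.
Proof.
move=> y0; have [u0 [w0 [yu0 s0 a0]]] := arrival_spec y0.
move: (base y0) => x0 in yu0 s0 a0; have t0 := sq_lift_tie _ _ _ s0.
move=> P /nbhs_dist_ball[e e0 eP].
have [N1 [d1 [N1x d10 near1]]] := travel_cont _ _ _ e t0 e0.
have [N2 [d2 [N2x d20 near2]]] := sq_lift_cont _ _ _ d1 s0 d10.
have hq : nbhs (x0, u0) [set q : X * R | (N1 `&` N2) q.1 /\ `|q.2 - u0| < Num.min d1 d2].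
  exists (N1 `&` N2, [set s | `|s - u0| < Num.min d1 d2]) => //=; split=> /=.
    exact: filterI.
  by apply: (dist_ball_nbhs _ (Num.min d1 d2)) => //; rewrite lt_min d10.
have := near_pt _ _ _ (tie_l _ _ _ t0) hq; rewrite -yu0 => h'.
apply: (@filterS _ (nbhs y0) _ _ _ _ h') => y [u [au yu [[/= Nx1 Nx2]]]].
rewrite lt_min => /andP[ud1 ud2]; apply: eP => /=.
have [w s] := sq_lift_exists _ _ au.
rewrite a0 yu (arrivalE _ _ _ s).
by have [_] := near1 _ u w Nx1 ud1 (near2 _ _ _ Nx2 ud2 s).
Qed.

Lemma arrival_unique (a b : Y -> R) : continuous a -> continuous b ->
  (forall y, hh y = F (y, a y)) -> (forall y, hh y = F (y, b y)) ->
  (forall y, hh y = y -> a y = 0) -> (forall y, hh y = y -> b y = 0) ->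
  a = b.
Proof.
move=> ca cb Fa Fb a0 b0.
have cab : continuous (fun y => a y - b y).
  by move=> y; exact: (@continuousB R R^o _ a b y (ca y) (cb y)).
have ab_full x s : full x -> a (pt x s) = b (pt x s).
  move=> fx; have [G lG] := has_lift x fx; have [_ hG _] := lG.
  have [c Gc] := lift_fix x G lG.
  have [m /andP[cs _]] := mod2pi s c; rewrite -(pt_shift x s m).
  have hc : hh (pt x c) = pt x c by rewrite /hh /= !hG !Gc.
  (* The chained relation is an implication: where [a] and [b] agree they agree nearby by
     [arrival_rigid]; where they differ they differ nearby, and the premise fails. *)
  apply: (segment_chain (fun s t => a (pt x s) = b (pt x s) ->
    a (pt x t) = b (pt x t)) c _ cs); last by rewrite a0 ?b0.
    by move=> ? ? ? ? ?; auto.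
  move=> d _; have [e|ne] := pselect (a (pt x d) = b (pt x d)).
    have hF : nbhs (pt x d) [set z | F (z, a z) = F (z, b z)].
      by apply: (@filterE _ (nbhs (pt x d))) => z /=; rewrite -Fa -Fb.
    have hr := arrival_rigid _ _ (pt x d) (ca _) (cb _) e hF.
    have [r r0 {}hr] := nbhs_dist_ball _ _ (nbhs_pairl _ _ _ (pt_cont _ _ (fx d) _ hr)).
    by exists r => // u v _ _ _ _ vr _; exact: hr.
  have n0 : 0 < `|a (pt x d) - b (pt x d)| by rewrite normr_gt0 subr_eq0; exact/eqP.
  have hr := continuous_dist _ _ _ (cab (pt x d)) n0.
  have [r r0 {}hr] := nbhs_dist_ball _ _ (nbhs_pairl _ _ _ (pt_cont _ _ (fx d) _ hr)).
  exists r => // u v _ _ _ ur _ uu; have := hr u ur.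
  by rewrite /= uu subrr sub0r normrN ltxx.
apply/funext => y; apply: contrapT => /eqP; rewrite -subr_eq0 -normr_gt0 => n0.
have hr := continuous_dist _ _ _ (cab y) n0.
have [s ys e] := ptP y; rewrite {1}e in hr.
have [x Wx fx] := dense_full _ _ (nbhs_pairr _ _ _ (pt_cont _ _ ys _ hr)).
move: Wx; rewrite /= ab_full // subrr sub0r normrN.
by rewrite ltxx.
Qed.

Lemma sq_orbit y : [set hh z | z in flow_orbit F y] = flow_orbit F y.
Proof.
apply/seteqP; split=> [_ [_ [t _ <-] <-]|_ [t _ <-]].
  by rewrite arrivalP flowD; eexists.
pose z := k (k (F (y, t))).
have hz : hh z = F (y, t) by rewrite /hh /= !kK.
exists z => //; have := arrivalP z; rewrite hz => e.
by exists (- arrival z + t) => //; rewrite -flowD e flowNK.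
Qed.

(** Both sides are times from [y] to [h (h y)] and agree at [y0], so [arrival_rigid] applies. On the
    right the flow enters only at the fixed time [arrival y0], so smoothness follows by composition,
    without an implicit function argument. *)
Lemma arrival_local y0 (T : topologicalType) (U : set Y) (phi : Y -> T * R) :
  flow_box_chart F (hh y0) U phi ->
  \forall y \near y0, arrival y =
    arrival y0 + ((phi (hh y)).2 - (phi (F (y, arrival y0))).2).
Proof.
set t0 := arrival y0 => box; have [_ Uh [_ cphi _ _] _] := box.
have crho : {for hh y0, continuous (fun y => (phi y).2)}.
  apply: (@continuous_comp _ _ _ phi snd); [exact: cphi|exact: cvg_snd].
have e0 : F (y0, t0) = hh y0 by rewrite arrivalP.
have [c ac hc] := ptP (hh y0); rewrite base_hh in ac hc.
rewrite hc in box.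
have [N [r [Nx r0 hN]]] := flow_box_leaf _ _ _ _ _ ac box.
have hq : nbhs (base y0, c) [set q : X * R | N q.1 /\ `|q.2 - c| < r].
  exists (N, [set s | `|s - c| < r]) => //; split=> //=.
  exact: (dist_ball_nbhs _ r).
have hW := near_pt _ _ _ ac hq; rewrite -hc in hW.
have c1 : {for y0, continuous (fun y => (phi (hh y)).2)}.
  apply: (@continuous_comp _ _ _ hh (fun y => (phi y).2)); [exact: cont_hh|exact: crho].
have c2 : {for y0, continuous (fun y => (phi (F (y, t0))).2)}.
  apply: (@continuous_comp _ _ _ (fun y => F (y, t0)) (fun y => (phi y).2)).
    exact: flow_cont_y.
  by rewrite e0; exact: crho.
apply: (arrival_rigid arrival (fun y => t0 + ((phi (hh y)).2 - (phi (F (y, t0))).2))).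
- exact: arrival_cont.
- have c0 := @cst_continuous Y R t0 y0.
  exact: (continuousD c0 (continuousB c1 c2)).
- by rewrite e0 subrr addr0.
have h1 := cont_hh _ _ hW.
have h2 : nbhs y0 _ := flow_cont_y t0 _ _ (eq_ind_r (fun z => nbhs z _) hW e0).
apply: (@filterS2 _ (nbhs y0) _ _ _ _ _ h1 h2) => y /= [s []].
rewrite base_hh => as_ hs [Nx' sr] [s' []]; rewrite base_flow => as' hs' [_ sr'].
rewrite -arrivalP addrC -flowD hs hs'.
by have [_ _] := hN _ s' s Nx' sr' sr.
Qed.

End FibredFlow.

(** * Maps of class C^k *)

Section Differentiability.
Context {R : realType}.
Implicit Types V W Z : normedModType R.

Lemma near_eq_diff V W (f g : V -> W) x : nbhs x [set y | f y = g y] ->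
  differentiable f x -> differentiable g x /\ 'd g x = 'd f x :> (V -> W).
Proof.
move=> fg df; have fx : f x = g x := nbhs_singleton fg.
have [cdf] := (diff_locallyP x f).1 df.
move/eqaddoP => h.
have shx : (fun y : V => y + x) @ (0 : V) --> x.
  have h0 := @cvgD _ _ _ (nbhs (0 : V)) _ id (cst x) 0 x (@cvg_id _ _) (@cvg_cst _ _ _ _ _).
  by move: h0; rewrite add0r; exact.
have h' : g \o shift x = cst (g x) + 'd f x +o_ (0 : V) id.
  apply/eqaddoP => e e0; have := h e e0; apply: filter_app.
  apply: (@filterS _ (nbhs (0 : V)) _ _ _ _ (shx _ fg)) => y /= fgy.
  by rewrite !fctE /= /shift /= -fgy -fx.
have E := diff_unique cdf h'.
split; last exact: E.
by apply/diff_locallyP; rewrite E; split; [exact: cdf|exact: h'].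
Qed.

(** The product rule, read as the differential of a continuous bilinear map composed with a pair. *)
Lemma diff_scale V W (a : V -> R) (b : V -> W) x :
  differentiable a x -> differentiable b x ->
  differentiable (fun y => a y *: b y) x /\
  'd (fun y => a y *: b y) x = (fun v => a x *: 'd b x v + 'd a x v *: b x) :> (V -> W).
Proof.
move=> da db.
have bil : bilinear_for (GRing.Scale.Law.clone _ _ *:%R _)
    (GRing.Scale.Law.clone _ _ *:%R _) (@GRing.scale R W).
  split=> [w|r] c u v /=; first by rewrite scalerDl -scalerA.
  by rewrite scalerDr !scalerA mulrC.
pose sB : {bilinear R -> W -> W} :=
  HB.pack (@GRing.scale R W) (bilinear_isBilinear.Build R R W W _ _ _ bil).
have cs : continuous (fun p : R * W => sB p.1 p.2) := @scale_continuous _ _.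
have dp := differentiable_pair da db.
have ds := @differentiable_bilin _ _ _ _ sB (a x, b x) cs.
have E : (fun y => a y *: b y) = (fun p => sB p.1 p.2) \o (fun y => (a y, b y)) by [].
split; first by rewrite E; exact: differentiable_comp.
by rewrite E diff_comp // diff_bilin // diff_pair.
Qed.

Lemma Ck_sub k V W (U U' : set V) (f : V -> W) : U' `<=` U ->
  Ck_on k U f -> Ck_on k U' f.
Proof.
move=> UU'; elim: k f => [f h x /UU'|k IH f [df h]]; first exact: h.
by split=> [x /UU'/df//|v]; exact/IH/h.
Qed.

(** Continuity and differentiability in [Ck_on] are taken in the whole of [V], so the sets [U'] need
    not be open. *)
Lemma Ck_local k V W (U : set V) (f : V -> W) :
  (forall x, U x -> exists2 U', U' x & Ck_on k U' f) -> Ck_on k U f.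
Proof.
elim: k f => [f h x /h[U' U'x]|k IH f h]; first exact.
split=> [x /h[U' U'x [df _]]|v]; first exact: df.
by apply: IH => x /h[U' U'x [_ hv]]; exists U' => //; exact: hv.
Qed.

Lemma Ck_congr k V W (U : set V) (f g : V -> W) : open U ->
  (forall x, U x -> f x = g x) -> Ck_on k U f -> Ck_on k U g.
Proof.
move=> oU; elim: k f g => [f g fg h x Ux|k IH f g fg [df h]].
  have nU : nbhs x U by apply: open_nbhs_nbhs.
  move=> P; rewrite -fg // => /(h x Ux) hP.
  by apply: (@filterS2 _ (nbhs x) _ _ _ _ _ nU hP) => y Uy /=; rewrite fg.
have dg x : U x -> differentiable g x /\ 'd g x = 'd f x :> (V -> W).
  move=> Ux; apply: near_eq_diff; last exact: df.
  have nU : nbhs x U by apply: open_nbhs_nbhs.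
  exact: (@filterS _ (nbhs x) _ _ _ fg nU).
split=> [x /dg[]//|v]; apply: (IH _ _ _ (h v)) => x Ux.
by have [_ ->] := dg x Ux.
Qed.

Lemma Ck_cst k V W (U : set V) (c : W) : Ck_on k U (fun=> c).
Proof.
elim: k c => [c x _|k IH c]; first exact: cst_continuous.
split=> [x _|v]; first exact: differentiable_cst.
rewrite (_ : (fun x => _) = (fun=> 0)); first exact: IH.
by apply/funext => x; rewrite (diff_cst c x).
Qed.

Lemma Ck_pred k V W (U : set V) (f : V -> W) : Ck_on k.+1 U f -> Ck_on k U f.
Proof.
elim: k f => [f [df _] x /df|k IH f [df h]].
  exact: differentiable_continuous.
by split=> // v; exact/IH/h.
Qed.

Lemma Ck_continuous k V W (U : set V) (f : V -> W) x : Ck_on k U f -> U x ->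
  {for x, continuous f}.
Proof. by elim: k f => [f h|k IH f /Ck_pred/IH//]; exact: h. Qed.

Lemma Ck_add k V W (U : set V) (f g : V -> W) : open U ->
  Ck_on k U f -> Ck_on k U g -> Ck_on k U (fun x => f x + g x).
Proof.
move=> oU; elim: k f g => [f g hf hg x Ux|k IH f g [df hf] [dg hg]].
  by apply: (@continuousD _ W _ f g); [exact: hf|exact: hg].
split=> [x Ux|v].
  by apply: (@differentiableD _ _ _ f g); [exact: df|exact: dg].
apply: (Ck_congr k _ _ _ (fun x => 'd f x v + 'd g x v)) => // [x Ux|].
  by rewrite (_ : (fun x => f x + g x) = f + g) // diffD; [|exact: df|exact: dg].
exact: IH (hf v) (hg v).
Qed.

Lemma Ck_scale k V W (U : set V) (a : V -> R) (b : V -> W) : open U ->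
  Ck_on k U a -> Ck_on k U b -> Ck_on k U (fun x => a x *: b x).
Proof.
move=> oU; elim: k a b => [a b ha hb x Ux|k IH a b ha hb].
  apply: (@continuous_comp _ _ _ (fun y => (a y, b y)) (fun p : R * W => p.1 *: p.2)).
    exact: cvg_pair (ha x Ux) (hb x Ux).
  exact: scale_continuous.
have [da ha'] := ha; have [db hb'] := hb; split=> [x Ux|v].
  by have [] := diff_scale _ _ _ _ x (da x Ux) (db x Ux).
apply: (Ck_congr k _ _ _ (fun x => a x *: 'd b x v + 'd a x v *: b x)) => // [x Ux|].
  by have [_ ->] := diff_scale _ _ _ _ x (da x Ux) (db x Ux).
apply: Ck_add => //.
- exact: IH (Ck_pred _ _ _ _ _ ha) (hb' v).
- exact: IH (ha' v) (Ck_pred _ _ _ _ _ hb).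
Qed.

Lemma Ck_sum k V W (I : finType) (U : set V) (f : I -> V -> W) : open U ->
  (forall i, Ck_on k U (f i)) -> Ck_on k U (fun x => \sum_i f i x).
Proof.
move=> oU hf; elim: (index_enum I) => [|i s IH].
  apply: (Ck_congr _ _ _ _ (fun=> 0)) => //; last exact: Ck_cst.
  by move=> x _; rewrite big_nil.
apply: (Ck_congr _ _ _ _ (fun x => f i x + \sum_(i <- s) f i x)) => //.
  by move=> x _; rewrite big_cons.
exact: Ck_add.
Qed.

Lemma Ck_linear_comp k V W Z (U : set V) (f : V -> W) (L : {linear W -> Z}) :
  open U -> continuous L -> Ck_on k U f -> Ck_on k U (fun x => L (f x)).
Proof.
move=> oU cL; elim: k f => [f hf x Ux|k IH f [df hf]].
  by apply: (@continuous_comp _ _ _ f L); [exact: hf|exact: cL].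
split=> [x Ux|v].
  apply: (@differentiable_comp _ _ _ _ f L); first exact: df.
  exact: linear_differentiable.
apply: (Ck_congr k _ _ _ (fun x => L ('d f x v))) => // [x Ux|]; last exact: IH (hf v).
have dfx := df x Ux; have dLx := @linear_differentiable _ _ _ L (f x) cL.
have E : 'd (fun x => L (f x)) x = 'd L (f x) \o 'd f x :> (V -> Z).
  exact: diff_comp dfx dLx.
by rewrite E /= diff_lin.
Qed.

(* Lets [Ck_comp] expand the derivative of a composite in coordinates, whence
   the restriction to finite dimension. *)
Definition finite_coords W := exists (I : finType) (e : I -> W)
  (c : I -> {linear W -> R}),
  (forall i, continuous (c i)) /\ forall w, w = \sum_i c i w *: e i.

Lemma Ck_comp k V W Z (U : set V) (U' : set W) (f : V -> W) (g : W -> Z) :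
  finite_coords W -> open U -> (forall x, U x -> U' (f x)) ->
  Ck_on k U f -> Ck_on k U' g -> Ck_on k U (fun x => g (f x)).
Proof.
move=> [I [e [c [cc ce]]]] oU UU'; elim: k g => [g hf hg x Ux|k IH g hf hg].
  by apply: (@continuous_comp _ _ _ f g); [exact: hf|apply: hg; exact: UU'].
have [df hf'] := hf; have [dg hg'] := hg; split=> [x Ux|v].
  by apply: (@differentiable_comp _ _ _ _ f g); [exact: df|apply: dg; exact: UU'].
apply: (Ck_congr k _ _ _ (fun x => \sum_i c i ('d f x v) *: 'd g (f x) (e i))) => //.
  move=> x Ux; have dfx := df x Ux; have dgx := dg _ (UU' x Ux).
  have E : 'd (fun x => g (f x)) x = 'd g (f x) \o 'd f x :> (V -> Z).
    exact: diff_comp dfx dgx.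
  rewrite E /= [in RHS](ce ('d f x v)).
  by rewrite linear_sum; apply: eq_bigr => i _; rewrite linearZ.
apply: Ck_sum => // i; apply: Ck_scale => //.
- exact: (Ck_linear_comp k _ _ _ U (fun x => 'd f x v) (c i) oU (cc i) (hf' v)).
- exact: (IH (fun w => 'd g w (e i)) (Ck_pred _ _ _ _ _ hf) (hg' (e i))).
Qed.

Lemma finite_coords_line : finite_coords R.
Proof.
exists unit, (fun=> 1), (fun=> idfun); split=> [_ x|w]; first exact: cvg_id.
by rewrite (big_pred1 tt) /=; [rewrite [RHS]mulr1|case].
Qed.

Lemma finite_coords_row n : finite_coords 'rV[R]_n.
Proof.
have lin i : linear (fun v : 'rV[R]_n => v 0 i) by move=> a u v; rewrite !mxE.
pose c i : {linear 'rV[R]_n -> R} :=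
  HB.pack (fun v : 'rV[R]_n => v 0 i) (GRing.isLinear.Build _ _ _ _ _ (lin i)).
exists 'I_n, (fun i => delta_mx 0 i), c; split=> [i|w].
  exact: (@coord_continuous R 1 n 0 i).
exact: row_sum_delta.
Qed.

Lemma finite_coords_prod V W : finite_coords V -> finite_coords W ->
  finite_coords (V * W)%type.
Proof.
move=> [I [e [c [cc ce]]]] [J [e' [c' [cc' ce']]]].
pose cV i := [the {linear (V * W)%type -> R} of c i \o fst].
pose cW j := [the {linear (V * W)%type -> R} of c' j \o snd].
exists (I + J)%type, (fun i => match i with inl i => (e i, 0) | inr j => (0, e' j) end),
  (fun i => match i with inl i => cV i | inr j => cW j end); split.
  case=> i x.
  - apply: (@continuous_comp _ _ _ fst (c i)); [exact: cvg_fst|exact: cc].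
  - apply: (@continuous_comp _ _ _ snd (c' i)); [exact: cvg_snd|exact: cc'].
move=> [v w]; rewrite big_sumType /=.
rewrite [in LHS](ce v) [in LHS](ce' w).
have E1 : \sum_i c i v *: ((e i, 0) : V * W) = (\sum_i c i v *: e i, 0).
  elim/big_rec2: _ => // i y1 y2 _ ->.
  by rewrite -[LHS]/(c i v *: e i + y1, c i v *: 0 + 0) scaler0 addr0.
have E2 : \sum_i c' i w *: ((0, e' i) : V * W) = (0, \sum_i c' i w *: e' i).
  elim/big_rec2: _ => // i y1 y2 _ ->.
  by rewrite -[LHS]/(c' i w *: 0 + 0, c' i w *: e' i + y1) scaler0 addr0.
rewrite E1 E2 -[RHS]/(\sum_i c i v *: e i + 0, 0 + \sum_i c' i w *: e' i).
by rewrite addr0 add0r.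
Qed.

(** Treats finite and infinite smoothness together: the admissible orders are [j] alone for
    [Some j], and all of them for [None]. *)
Lemma Cr_onP r V W (U : set V) (f : V -> W) :
  Cr_on r U f <-> forall k, (if r is Some j then k = j else True) -> Ck_on k U f.
Proof.
by case: r => [j|] /=; split=> [h k|h]; [move->|exact: h|move=> _; exact: h|move=> k; exact: h].
Qed.

Lemma Cr_continuous r V W (U : set V) (f : V -> W) x : Cr_on r U f -> U x ->
  {for x, continuous f}.
Proof. by case: r => [k|] /=; [|move/(_ 0%N)]; exact: Ck_continuous. Qed.

Lemma Ck_pair_cst k V W (U : set V) (c : W) : Ck_on k U (fun x => (x, c)).
Proof.
case: k => [|k].
  by move=> x _; apply: cvg_pair; [exact: cvg_id|exact: cvg_cst].
have did x : differentiable (id : V -> V) x by exact: ex_diff.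
have dc x : differentiable (cst c : V -> W) x by exact: differentiable_cst.
split=> [x _|v]; first exact: (differentiable_pair (did x) (dc x)).
rewrite (_ : (fun x => _) = (fun=> (v, 0))); first exact: Ck_cst.
apply/funext => x; have -> : 'd (fun y => (y, c)) x =
    (fun v => ('d id x v, 'd (cst c) x v)) :> (V -> V * W).
  exact: (diff_pair (did x) (dc x)).
rewrite (diff_cst c x); congr (_, _).
have E : 'd (idfun : V -> V) x = idfun :> (V -> V).
  by apply: diff_lin => y; exact: cvg_id.
exact: (congr1 (fun f : V -> V => f v) E).
Qed.

End Differentiability.

(** * Charts *)

Section OpenEmbeddings.

Lemma open_embedding_prod (M N M' N' : topologicalType) (U : set M) (U' : set M')
    (f : M -> N) (f' : M' -> N') :
  open_embedding U f -> open_embedding U' f' ->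
  open_embedding (U `*` U') (fun z => (f z.1, f' z.2)).
Proof.
move=> [oU cf jf of_] [oU' cf' jf' of'].
have nbhs_im (P : topologicalType) (Q : topologicalType) (V : set P) (g : P -> Q) x A :
    open V -> (forall W, open W -> W `<=` V -> open (g @` W)) -> V x -> nbhs x A ->
    nbhs (g x) (g @` A).
  move=> oV og Vx nA; have nV : nbhs x V by apply: open_nbhs_nbhs.
  have oW := open_interior (A `&` V).
  have Wx : (A `&` V)° x by exact: filterI.
  have WV : (A `&` V)° `<=` V by move=> y /interior_subset[].
  apply: (@filterS _ (nbhs (g x)) _ (g @` (A `&` V)°)); last first.
    by apply: open_nbhs_nbhs; split; [exact: og|exists x].
  by move=> _ [y /interior_subset[Ay _] <-]; exists y.
split.
- rewrite openE => -[x x'] [/= Ux Ux']; exists (U, U') => //=.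
  by split; apply: open_nbhs_nbhs.
- move=> [x x'] [/= Ux Ux'] P [[A B] /= [hA hB] AB].
  exists (f @^-1` A, f' @^-1` B) => /=; first by split; [exact: cf|exact: cf'].
  by move=> [y y'] [/= Ay By]; apply: AB.
- move=> [x x'] [y y']; rewrite !inE => -[/= Ux Ux'] [/= Uy Uy'] [e e'].
  by congr (_, _); [apply: jf|apply: jf']; rewrite ?inE.
- move=> W oW WU; rewrite openE => _ [[x x'] Wx <-] /=.
  have [/= Ux Ux'] := WU _ Wx.
  have [[A B] /= [hA hB] AB] : nbhs (x, x') W by apply: open_nbhs_nbhs.
  exists (f @` A, f' @` B) => /=.
    by split; [exact: (nbhs_im _ _ U)|exact: (nbhs_im _ _ U')].
  move=> [y y'] [/= [z Az <-] [z' Bz' <-]].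
  by exists (z, z') => //; apply: AB.
Qed.

Lemma open_embedding_sub (M N : topologicalType) (Y : set M) (U : set M) (f : M -> N) :
  open Y -> open_embedding U f ->
  open_embedding (set_val @^-1` U : set Y) (f \o set_val).
Proof.
move=> oY [oU cf jf of_]; have cv := @initial_continuous _ _ (set_val : Y -> M).
split.
- by apply: open_comp oU => y _; exact: cv.
- move=> y Uy; apply: (@continuous_comp _ _ _ (set_val : Y -> M) f); first exact: cv.
  exact: cf.
- move=> y z; rewrite !inE => Uy Uz e; apply: val_inj.
  by rewrite -!set_valE; apply: jf; rewrite ?inE.
- move=> _ [V oV <-] WU.
  rewrite (_ : _ @` _ = f @` (V `&` Y `&` U)).
    by apply: of_; [apply: openI => //; exact: openI|move=> x []].
  apply/seteqP; split=> [z [y Vy <-]|z [x [[Vx Yx] Ux] <-]].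
    exists (set_val y) => //; split; last exact: WU.
    by split=> //; exact: set_valP.
  by exists (exist _ x (mem_set Yx)).
Qed.

Lemma open_embedding_id (M : topologicalType) : open_embedding setT (@id M).
Proof.
split=> [|x _|x y _ _ //|W oW _].
- exact: openT.
- exact: cvg_id.
- by rewrite image_id.
Qed.

Context {R : realType}.

(* Stereographic projection from [(0, e)], [e = 1] or [e = -1]; its inverse maps
   [t] to [(2t, e(t^2 - 1)) / (t^2 + 1)]. *)
Lemma open_embedding_stereo (e : R) : e ^+ 2 = 1 ->
  open_embedding [set p : circle R | (set_val p).2 != e]
    (fun p : circle R => (set_val p).1 / (1 - e * (set_val p).2)).
Proof.
move=> e2; pose U := [set p : circle R | (set_val p).2 != e].
pose f (p : circle R) := (set_val p).1 / (1 - e * (set_val p).2).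
have d0 t : t ^+ 2 + 1 != 0 :> R by apply/eqP; nra.
have inv_sub t : (2 * t / (t ^+ 2 + 1), e * (t ^+ 2 - 1) / (t ^+ 2 + 1)) \in circle R.
  apply/mem_set; rewrite /circle /= !expr_div_n !exprMn e2 mul1r -mulrDl.
  by rewrite (_ : 2 ^+ 2 * _ + _ = (t ^+ 2 + 1) ^+ 2); [rewrite divff // expf_neq0|ring].
pose g t : circle R := 
  @exist (R * R) (fun p => p \in circle R) _ (inv_sub t).
have gU t : U (g t).
  rewrite /U /= ; apply/eqP => h.
  have h' : e * (t ^+ 2 - 1) = e * (t ^+ 2 + 1) by rewrite -{2}h divfK.
  have e0 : e = 0 by lra.
  by move: e2; rewrite e0 expr0n /= => /esym/eqP; rewrite oner_eq0.
have gK t : f (g t) = t.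
  rewrite /f /=; rewrite (_ : 1 - _ = 2 / (t ^+ 2 + 1)).
    by field; rewrite d0.
  by rewrite !mulrA -expr2 e2; field.
have denom p : U p -> 1 - e * (set_val p).2 != 0.
  move=> Up; apply/eqP => h; move/eqP: Up; apply.
  have eb : e * (set_val p).2 = 1 := esym (subr0_eq h).
  by transitivity (e * (e * (set_val p).2)); [rewrite mulrA -expr2 e2 mul1r|rewrite eb mulr1].
have key (a b : R) : 1 - e * b != 0 -> a ^+ 2 + b ^+ 2 = 1 ->
    let t := a / (1 - e * b) in
    (2 * t / (t ^+ 2 + 1), e * (t ^+ 2 - 1) / (t ^+ 2 + 1)) = (a, b).
  set D := 1 - e * b => d c /=.
  (* On the circle [a ^+ 2 = 1 - (e b) ^+ 2], and [1 + e b = 2 - D]; hence [t ^+ 2 + 1 = 2 / D],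
     which collapses the inverse formula. *)
  have aD : a ^+ 2 = D * (2 - D).
    rewrite (_ : D * (2 - D) = 1 - e ^+ 2 * b ^+ 2); last by rewrite /D; ring.
    by rewrite e2 mul1r -c addrK.
  have q : (a / D) ^+ 2 = 2 / D - 1 by rewrite expr_div_n aD; field.
  rewrite q subrK; congr (_, _); first by field.
  rewrite (_ : e * _ / _ = e * (1 - D)); last by field.
  by rewrite /D (_ : e * _ = e ^+ 2 * b); [rewrite e2 mul1r|ring].
have fK p : U p -> g (f p) = p.
  move=> Up; apply: val_inj; rewrite [RHS]surjective_pairing.
  exact: key (denom p Up) (circleP p).
have c1 : continuous (fun p : circle R => (set_val p).1) := circle1_cont.
have c2 : continuous (fun p : circle R => (set_val p).2) := circle2_cont.
have cg : continuous g.
  apply: continuous_comp_initial => t.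
  have ct : {for t, continuous (fun t : R => t)} by exact: cvg_id.
  have cc (a : R) : {for t, continuous (fun _ : R => a)} by exact: cvg_cst.
  have cq : {for t, continuous (fun t : R => t ^+ 2)} := continuousM ct ct.
  have cd : {for t, continuous (fun t : R => (t ^+ 2 + 1)^-1)}.
    apply: (@continuousV _ _ (fun t : R => t ^+ 2 + 1) t (d0 t)).
    exact: (continuousD cq (cc 1)).
  have k1 := continuousM (continuousM (cc 2) ct) cd.
  have k2 := continuousM (continuousM (cc e) (continuousB cq (cc 1))) cd.
  exact: (cvg_pair k1 k2).
have cf p : U p -> {for p, continuous f}.
  move=> Up; have cc (a : R) : {for p, continuous (fun _ : circle R => a)}.
    exact: (@cst_continuous (circle R) R).
  have cd : {for p, continuous (fun p : circle R => 1 - e * (set_val p).2)}.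
    exact: (continuousB (cc 1) (continuousM (cc e) (c2 p))).
  exact: (continuousM (c1 p) (@continuousV _ _
    (fun p : circle R => 1 - e * (set_val p).2) p (denom p Up) cd)).
have oim (W : set (circle R)) : open W -> W `<=` U -> open (f @` W).
  move=> oW WU; have -> : f @` W = g @^-1` W.
    apply/seteqP; split=> [z [p Wp <-]|t Wt] /=.
      by rewrite fK //; exact: WU.
    by exists (g t) => //; exact: gK.
  by apply: open_comp => // t _; exact: cg.
have oU : open U.
  pose k (p : circle R) := (set_val p).2.
  have -> : U = k @^-1` [set t | t != e] by [].
  by apply: open_comp; [move=> p _; exact: c2|exact: open_neq].
split.
- exact: oU.
- exact: cf.
- by move=> p q; rewrite !inE => Up Uq /(congr1 g); rewrite !fK.
- exact: oim.
Qed.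

End OpenEmbeddings.

Section Charts.
Context {R : realType}.

Definition line_chart : chart R R := Chart setT id.

Lemma circle_atlas_embedding (c : chart (circle R) R) : circle_atlas c ->
  open_embedding (chart_dom c) (chart_map c).
Proof.
case=> ->; have [e2 e2'] : 1 ^+ 2 = 1 :> R /\ (-1) ^+ 2 = 1 :> R by rewrite sqrrN expr1n.
- have := open_embedding_stereo 1 e2; rewrite (_ : (fun p : circle R => _) =
    (fun p : circle R => (set_val p).1 / (1 - (set_val p).2))) //.
  by apply/funext => p; rewrite mul1r.
- have := open_embedding_stereo (-1) e2'; rewrite (_ : (fun p : circle R => _) =
    (fun p : circle R => (set_val p).1 / (1 + (set_val p).2))) //.
  by apply/funext => p; rewrite mulN1r opprK.
Qed.

Lemma circle_atlas_cover (p : circle R) : exists2 c, circle_atlas c & chart_dom c p.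
Proof.
have [p1|p1] := eqVneq (set_val p).2 1.
- exists (Chart [set p : circle R | (set_val p).2 != -1]
    (fun p => (set_val p).1 / (1 + (set_val p).2))); first by right.
  by rewrite /= p1 gt_eqF //; lra.
- by exists (Chart [set p : circle R | (set_val p).2 != 1]
    (fun p => (set_val p).1 / (1 - (set_val p).2))); first by left.
Qed.

Section TotalAtlas.
Context {X : topologicalType} {E : normedModType R} (Y : set (X * circle R))
  (A : set (chart X E)).
Hypotheses (openY : open Y)
  (embA : forall c, A c -> open_embedding (chart_dom c) (chart_map c))
  (coverA : forall x, exists2 c, A c & chart_dom c x).

Lemma total_atlas_embedding c : total_atlas Y A c ->
  open_embedding (chart_dom c) (chart_map c).
Proof.
move=> [_ [c1 Ac1 [c2 Ac2 <-]] <-].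
exact: (open_embedding_sub _ _ _ _ _ openY (open_embedding_prod _ _ _ _ _ _ _ _
  (embA _ Ac1) (circle_atlas_embedding _ Ac2))).
Qed.

Lemma total_atlas_cover y : exists2 c, total_atlas Y A c & chart_dom c y.
Proof.
have [c1 Ac1 d1] := coverA (set_val y).1.
have [c2 Ac2 d2] := circle_atlas_cover (set_val y).2.
eexists; first by exists (prod_chart c1 c2) => //; exists c1 => //; exists c2.
by split.
Qed.

End TotalAtlas.

(** Germ version of [Cr_in_charts]: [g] has to express [f] only near [x], so composites need no
    common domain. *)
Definition smooth_at (r : smoothness) (M N : topologicalType)
    (E E' : normedModType R) (c : chart M E) (c' : chart N E') (f : M -> N) (x : M) :=
  exists (g : E -> E') (W : set E), [/\ open W, W (chart_map c x), Cr_on r W g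
    & nbhs x [set z | g (chart_map c z) = chart_map c' (f z)]].

Arguments smooth_at r {M N E E'} c c' f x.

Lemma Cr_map_smooth_at r (M N : topologicalType) (E E' : normedModType R)
    (A : set (chart M E)) (A' : set (chart N E')) U c c' (f : M -> N) x :
  Cr_map_on r A A' U f -> A c -> A' c' ->
  open_embedding (chart_dom c) (chart_map c) -> open (chart_dom c') ->
  open U -> U x -> chart_dom c x -> chart_dom c' (f x) -> smooth_at r c c' f x.
Proof.
move=> [cf Af] Ac Ac' [oc cc _ ec] oc' oU Ux cx c'x.
have [g [Cg gE]] := Af c c' Ac Ac'.
set D := U `&` chart_dom c `&` f @^-1` chart_dom c' in Cg gE.
have nD : nbhs x D.
  apply: filterI; first by apply: filterI; apply: open_nbhs_nbhs.
  by apply: (cf x Ux); apply: open_nbhs_nbhs.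
exists g, (chart_map c @` D°); split.
- by apply: ec; [exact: open_interior|move=> z /interior_subset[[]]].
- by exists x.
- apply/Cr_onP => k kr; apply: Ck_sub ((Cr_onP _ _ _ _ _).1 Cg k kr).
  by move=> _ [z /interior_subset Dz <-]; exists z.
- by apply: (@filterS _ (nbhs x) _ _ _ _ nD).
Qed.

Lemma smooth_at_comp r (M N P : topologicalType) (E E' E'' : normedModType R)
    (c : chart M E) (c' : chart N E') (c'' : chart P E'') (f : M -> N) (g : N -> P) x :
  finite_coords E' -> {for x, continuous f} ->
  smooth_at r c c' f x -> smooth_at r c' c'' g (f x) ->
  smooth_at r c c'' (fun z => g (f z)) x.
Proof.
move=> fin cf [f1 [W1 [oW1 W1x Cf1 f1E]]] [g1 [W2 [oW2 W2x Cg1 g1E]]].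
have oW : open (W1 `&` f1 @^-1` W2).
  rewrite openE => e [W1e W2e]; apply: filterI; first exact: open_nbhs_nbhs.
  by apply: (Cr_continuous _ _ _ _ _ _ Cf1 W1e); apply: open_nbhs_nbhs.
exists (fun e => g1 (f1 e)), (W1 `&` f1 @^-1` W2); split=> //.
- by split=> //=; rewrite (nbhs_singleton f1E).
- apply/Cr_onP => k kr.
  apply: (Ck_comp k _ _ _ _ W2 f1 g1 fin oW); first by move=> e [].
    by apply: Ck_sub ((Cr_onP _ _ _ _ _).1 Cf1 k kr) => e [].
  exact: (Cr_onP _ _ _ _ _).1 Cg1 k kr.
- apply: (@filterS2 _ (nbhs x) _ _ _ _ _ f1E (cf _ g1E)) => z /= -> //.
Qed.

Lemma smooth_at_snd r (M N : topologicalType) (E E' : normedModType R)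
    (c : chart M E) (c' : chart N E') (f : M -> N * R) x :
  smooth_at r c (prod_chart c' line_chart) f x ->
  smooth_at r c line_chart (fun z => (f z).2) x.
Proof.
move=> [g [W [oW Wx Cg gE]]]; exists (fun e => (g e).2), W; split=> //.
- apply/Cr_onP => k kr.
  apply: (Ck_linear_comp k _ _ _ _ g [the {linear (E' * R)%type -> R} of snd]) => //.
    by move=> e; exact: cvg_snd.
  exact: (Cr_onP _ _ _ _ _).1 Cg k kr.
- by apply: (@filterS _ (nbhs x) _ _ _ _ gE) => z /= ->.
Qed.

Lemma smooth_at_slice r (M N : topologicalType) (E E' : normedModType R)
    (c : chart M E) (c' : chart N E') (F : M * R -> N) x t :
  finite_coords E ->
  smooth_at r (prod_chart c line_chart) c' F (x, t) ->
  smooth_at r c c' (fun z => F (z, t)) x.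
Proof.
move=> fin [g [W [oW Wx Cg gE]]]; exists (fun e => g (e, t)), [set e | W (e, t)].
have oW' : open [set e | W (e, t)].
  rewrite openE => e We; have nW : nbhs (e, t) W by apply: open_nbhs_nbhs.
  exact: (Ck_pair_cst 0 _ _ setT t e I _ nW).
split=> //.
- apply/Cr_onP => k kr.
  apply: (Ck_comp k _ _ _ _ W (fun e => (e, t)) g
    (finite_coords_prod _ _ fin finite_coords_line) oW') => //.
    exact: Ck_pair_cst.
  exact: (Cr_onP _ _ _ _ _).1 Cg k kr.
- case: gE => -[P Q] /= [nP nQ] PQ; apply: (@filterS _ (nbhs x) _ _ _ _ nP) => z Pz.
  by apply: (PQ (z, t)); split=> //; exact: nbhs_singleton nQ.
Qed.

Lemma smooth_at_line_combine r (M : topologicalType) (E : normedModType R)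
    (c : chart M E) (f a b : M -> R) (t : R) x :
  nbhs x [set z | f z = t + (a z - b z)] ->
  smooth_at r c line_chart a x -> smooth_at r c line_chart b x ->
  smooth_at r c line_chart f x.
Proof.
move=> fE [a1 [W1 [oW1 W1x Ca aE]]] [b1 [W2 [oW2 W2x Cb bE]]].
have oW : open (W1 `&` W2) by exact: openI.
exists (fun e => t + (a1 e + (-1) *: b1 e)), (W1 `&` W2); split=> //.
- apply/Cr_onP => k kr; apply: Ck_add => //; first exact: Ck_cst.
  apply: Ck_add => //.
    by apply: Ck_sub ((Cr_onP _ _ _ _ _).1 Ca k kr) => e [].
  apply: Ck_scale => //; first exact: Ck_cst.
  by apply: Ck_sub ((Cr_onP _ _ _ _ _).1 Cb k kr) => e [].
- apply: (@filterS3 _ (nbhs x) _ _ _ _ _ _ fE aE bE) => z /= -> -> ->.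
  by rewrite scaleN1r.
Qed.

(** A chart is injective, so the coordinate expression is forced on its image; extended by 0, it
    agrees near each image point with a smooth germ. *)
Lemma smooth_at_in_charts r (M : topologicalType) (E : normedModType R)
    (c : chart M E) (f : M -> R) :
  open_embedding (chart_dom c) (chart_map c) ->
  (forall x, chart_dom c x -> smooth_at r c line_chart f x) ->
  Cr_in_charts r c line_chart setT f.
Proof.
move=> [oc cc ic ec] sf.
pose g (e : E) : R := if pselect (exists2 x, chart_dom c x & chart_map c x = e)
  is left ex then f (s2val (cid2 ex)) else 0.
have gE x : chart_dom c x -> g (chart_map c x) = f x.
  move=> cx; rewrite /g; case: pselect => [ex|[]]; last by exists x.
  by case: (cid2 ex) => z /= cz ez; congr f; apply: ic; rewrite ?inE.
exists g; split=> [|x [[_ cx] _]]; last exact: gE.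
apply/Cr_onP => k kr; apply: Ck_local => _ [x [[_ cx] _] <-].
have [g1 [W [oW Wx Cg1 g1E]]] := sf x cx.
have oc' : nbhs x (chart_dom c) by apply: open_nbhs_nbhs.
have nO := filterI g1E oc'; set O := _ `&` _ in nO.
have oW' : open (W `&` chart_map c @` O°).
  apply: openI => //; apply: ec; first exact: open_interior.
  by move=> z /interior_subset[].
have Ox : O° x by exact: nO.
exists (W `&` chart_map c @` O°); first by split=> //; exists x.
apply: (Ck_congr k _ _ _ g1) => //.
  by move=> _ [_ [z /interior_subset[/= e cz] <-]]; rewrite gE.
by apply: Ck_sub ((Cr_onP _ _ _ _ _).1 Cg1 k kr) => e [].
Qed.

(** Near [y], with [rho] the second coordinate of a flow box at [h (h y)], the function [a] is a
    constant plus [rho] after [h \o h] minus [rho] after the flow at time [a y]; charts are chained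
    through [h y] and through [h (h y) = F (y, a y)]. *)
Lemma smooth_arrival r (M : topologicalType) (E : normedModType R)
    (A : set (chart M E)) (F : M * R -> M) (h : M -> M) (a : M -> R) :
  finite_coords E ->
  (forall c, A c -> open_embedding (chart_dom c) (chart_map c)) ->
  (forall x, exists2 c, A c & chart_dom c x) ->
  Cr_map r (prod_atlas A line_atlas) A F -> Cr_map r A A h -> continuous a ->
  (forall y, has_Cr_flow_box r A F y) ->
  (forall y, h (h y) = F (y, a y)) ->
  (forall y (T : topologicalType) (U : set M) (phi : M -> T * R),
    flow_box_chart F (h (h y)) U phi ->
    nbhs y [set z | a z = a y + ((phi (h (h z))).2 - (phi (F (z, a y))).2)]) ->
  Cr_map r A line_atlas a.
Proof.
move=> fin emb cov CF Ch ca box Fa loc; split=> [x _|c _ Ac ->]; first exact: ca.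
apply: (smooth_at_in_charts _ _ _ _ _ (emb c Ac)) => y cy.
have [T [m [AT [U [phi [CAT fb Cphi]]]]]] := box (h (h y)).
have [embT covT _] := CAT; have [[oU _ _ _] mphi _] := Cphi.
have [_ Uy _ _] := fb.
have opend (c' : chart M E) : A c' -> open (chart_dom c') by move=> /emb[].
have [c1 Ac1 d1] := cov (h y); have [c2 Ac2 d2] := cov (h (h y)).
have [cT AcT dT] := covT (phi (h (h y))).1.
have line : line_atlas line_chart :> Prop by [].
have oline : open (chart_dom line_chart) by exact: openT.
have sh : smooth_at r c c1 h y.
  exact: (Cr_map_smooth_at _ _ _ _ _ _ _ _ _ _ _ _ Ch Ac Ac1 (emb _ Ac) (opend _ Ac1) openT).
have sh' : smooth_at r c1 c2 h (h y).
  exact: (Cr_map_smooth_at _ _ _ _ _ _ _ _ _ _ _ _ Ch Ac1 Ac2 (emb _ Ac1) (opend _ Ac2) openT).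
have srho : smooth_at r c2 line_chart (fun z => (phi z).2) (h (h y)).
  apply: (smooth_at_snd _ _ _ _ _ _ cT).
  apply: (Cr_map_smooth_at _ _ _ _ _ _ _ _ _ _ _ _ mphi Ac2 _ (emb _ Ac2) _ oU Uy d2) => //.
    by exists cT => //; exists line_chart.
  have [oT _ _ _] := embT _ AcT.
  by have [] := open_embedding_prod _ _ _ _ _ _ _ _ (embT _ AcT) (open_embedding_id R).
have sF : smooth_at r c c2 (fun z => F (z, a y)) y.
  apply: (smooth_at_slice _ _ _ _ _ _ _ _ _ _ fin).
  apply: (Cr_map_smooth_at _ _ _ _ _ _ _ _ _ _ _ _ CF _ Ac2 _ (opend _ Ac2) openT) => //.
  - by exists c => //; exists line_chart.
  - exact: open_embedding_prod (emb _ Ac) (open_embedding_id R).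
  - by rewrite -Fa.
have ch x : {for x, continuous h} := Ch.1 x I.
have cF : {for y, continuous (fun z => F (z, a y))}.
  apply: (@continuous_comp _ _ _ (fun z => (z, a y)) F); last exact: CF.1.
  move=> P [[P1 P2] /= [nP nQ] PQ]; apply: (@filterS _ (nbhs y) _ _ _ _ nP) => z Pz.
  by apply: (PQ (z, a y)); split=> //; exact: nbhs_singleton nQ.
have srhoF : smooth_at r c2 line_chart (fun z => (phi z).2) (F (y, a y)) by rewrite -Fa.
have s2 := smooth_at_comp _ _ _ _ _ _ _ c1 c2 line_chart h (fun z => (phi z).2) (h y)
  fin (ch _) sh' srho.
have s1 := smooth_at_comp _ _ _ _ _ _ _ c c1 line_chart h (fun z => (phi (h z)).2) y
  fin (ch _) sh s2.
have s3 := smooth_at_comp _ _ _ _ _ _ _ c c2 line_chart (fun z => F (z, a y))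
  (fun z => (phi z).2) y fin cF sF srhoF.
exact: (smooth_at_line_combine _ _ _ _ _ _ _ _ _ (loc y T U phi fb) s1 s3).
Qed.

End Charts.

(** * Orbits as components of leaves, and the conclusion *)

Section OrbitsInLeaves.
Context {R : realType} {X : topologicalType} (Y : set (X * circle R))
  (F : Y * R -> Y).
Hypotheses (flowF : is_flow F)
  (Phi1 : [set set_val @` flow_orbit F y | y in [set: Y]] =
          \bigcup_(x in [set: X]) components (leaf Y x)).

Lemma orbit_leaf y : exists x, components (leaf Y x) (set_val @` flow_orbit F y).
Proof.
have : (\bigcup_(x in [set: X]) components (leaf Y x)) (set_val @` flow_orbit F y).
  by rewrite -Phi1; exists y.
by case=> x _ h; exists x.
Qed.

Lemma orbit_base y x : components (leaf Y x) (set_val @` flow_orbit F y) ->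
  forall z, flow_orbit F y z -> base Y z = x.
Proof.
move=> [w _ e] z yz; have : (set_val @` flow_orbit F y) (set_val z) by exists z.
by rewrite -e => /connected_component_sub[[zx _] _]; exact: zx.
Qed.

Lemma self_orbit y : flow_orbit F y y.
Proof. by exists 0 => //; case: flowF. Qed.

(** An orbit is a component of a single leaf, so it stays over one base point. *)
Lemma flow_base y t : base Y (F (y, t)) = base Y y.
Proof.
have [x hx] := orbit_leaf y; have h := orbit_base y x hx.
by rewrite (h _ (self_orbit y)) h //; exists t.
Qed.

Lemma finite_orbits : (forall x, finite_set (components (leaf Y x))) ->
  forall x, finite_set [set set_val @` flow_orbit F y | y in [set y | base Y y = x]].
Proof.
move=> fin x; apply: sub_finite_set (fin x) => _ [y /= yx <-].
have [x' hx'] := orbit_leaf y.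
by rewrite -yx (orbit_base y x' hx' _ (self_orbit y)).
Qed.

End OrbitsInLeaves.

Theorem theorem6p2 (R : realType) (X : topologicalType)
  (Y : set (X * circle R)) (F : Y * R -> Y) (h : Y -> Y)
  (hausX : hausdorff_space X)
  (openY : open Y)
  (flowF : is_flow F)
  (Phi1 : [set set_val @` flow_orbit F y | y in [set: Y]] =
          \bigcup_(x in [set: X]) components (leaf Y x))
  (Phi2 : forall y : Y, has_flow_box F y)
  (Phi3 : dense (full_fibres Y))
  (Phi4 : forall x : X, finite_set (components (leaf Y x)))
  (homeo_h : homeomorphism h)
  (h_fibre : forall (x : X) (y : Y),
     leaf Y x (set_val y) -> fibre x (set_val (h y)))
  (h_degree : forall (x : X) (Bx : full_fibres Y x),
     has_degree (fibre_map h Bx) (-1)) :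
  exists alpha : Y -> R,
    [/\ unique (fun a : Y -> R =>
          [/\ continuous a,
              forall y : Y, h (h y) = F (y, a y)
            & forall y : Y, a y = 0 <-> h (h y) = y]) alpha,
        forall y : Y, [set h (h z) | z in flow_orbit F y] = flow_orbit F y
      & forall (r : smoothness) (n : nat) (A : set (chart X 'rV[R]_n)),
          Cr_atlas r A ->
          Cr_map r (prod_atlas (total_atlas Y A) line_atlas) (total_atlas Y A)
            F ->
          (forall y : Y, has_Cr_flow_box r (total_atlas Y A) F y) ->
          Cr_map r (total_atlas Y A) (total_atlas Y A) h ->
          Cr_map r (total_atlas Y A) line_atlas alpha].
Proof.
have base_flow := flow_base Y F flowF Phi1.
have fin_orbits := finite_orbits Y F flowF Phi1 Phi4.
have [cont_h [k [cont_k hK kK]]] := homeo_h.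
have base_h y : base Y (h y) = base Y y.
  have [|/= hb _] := h_fibre (base Y y) y; last exact: hb.
  by split; [split|exact: set_valP].
(* [pt] needs a default point of [Y], so the empty case is settled apart. *)
have [[yd]|noY] := pselect (inhabited Y); last first.
  exists (fun=> 0); split; first split.
  - by split=> [y|y|y]; case: noY.
  - by move=> a _; apply/funext => y; case: noY.
  - by move=> y; case: noY.
  - move=> r n A _ _ _ _; split=> [y|c c' _ _]; first by case: noY.
    exists (fun=> 0); split=> [|y]; last by case: noY.
    by apply/Cr_onP => j _; exact: Ck_cst.
have dense_full (x : X) (W : set X) : nbhs x W -> exists2 x', W x' & full Y x'.
  move=> nW; have [||x' [Wx' fx']] := Phi3 W°.
  - by exists x; exact: nW.
  - exact: open_interior.
  - by exists x'; [exact: interior_subset Wx'|exact: (fullP Y x').1 fx'].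
have has_lift x : full Y x -> exists G, is_lift Y yd h x G.
  move=> fx; have Bx : full_fibres Y x by apply/fullP.
  have [G [cG Gh Gs]] := h_degree x Bx; exists G; split=> // s.
    have e : pt Y yd x s = exist _ (x, expi s) (full_fibre_mem Bx (expi s)).
      by apply: val_inj; rewrite -set_valE val_pt.
    have [|_ ->] := pt_eq Y yd (h (pt Y yd x s)) x (G s); last by [].
    rewrite Gh /fibre_map -e [LHS]surjective_pairing; congr (_, _).
    by have := base_h (pt Y yd x s); rewrite /base => ->; rewrite val_pt.
  by rewrite Gs mulN1r.
have ca := arrival_cont Y yd openY F flowF base_flow Phi2 h k cont_h cont_k hK kK base_h
  fin_orbits dense_full has_lift.
have Fa := arrivalP Y yd openY F flowF base_flow Phi2 h k cont_h cont_k hK kK base_h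
  fin_orbits dense_full has_lift.
have a0 := arrival_eq0 Y yd openY F flowF base_flow Phi2 h k cont_h cont_k hK kK base_h
  fin_orbits dense_full has_lift.
set a := arrival Y yd F h in ca Fa a0.
exists a; split.
- split=> // b [cb Fb b0].
  apply: (arrival_unique Y yd openY F flowF Phi2 h dense_full has_lift) => //.
  + by move=> y /a0.
  + by move=> y /b0.
- exact: (sq_orbit Y yd openY F flowF base_flow Phi2 h k cont_h cont_k hK kK base_h
    fin_orbits dense_full has_lift).
- move=> r n A [embA covA _] CF box Ch.
  have fin : finite_coords ('rV[R]_n * R)%type :=
    finite_coords_prod _ _ (finite_coords_row n) finite_coords_line.
  apply: (smooth_arrival r _ _ (total_atlas Y A) F h a fin) => //.
  + exact: total_atlas_embedding.
  + exact: total_atlas_cover.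
  + move=> y T U phi.
    exact: (arrival_local Y yd openY F flowF base_flow Phi2 h k cont_h cont_k hK kK base_h
      fin_orbits dense_full has_lift).
Qed.
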